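(* Let $(\mathfrak g,\mathfrak g^* )$ be a factorizable Lie bialgebra with Poisson Lie group $G$, let $\sigma\in\mathrm{Aut}\,G$ satisfy $\sigma\circ r=r\circ\sigma$ and $\langle\sigma X,\sigma Y\rangle=\langle X,Y\rangle$ for all $X,Y\in\mathfrak g$, let $D=G\times G$ be the double of $G$ and let $D_\sigma$ be the twisted Heisenberg double. Then: (i) The actions of $D$ on $D_\sigma$ by right and left translations, $$D\times D_\sigma\stackrel{L}{\to}D_\sigma,\quad d'\circ d=d\,\big((d')^{T}\big)^{-1};\qquad D_\sigma\times D\stackrel{R}{\to}D_\sigma,\quad d\circ d'=(d')^{-1}d,$$ where $d\in D_\sigma$, $d'\in D$, are Poisson group actions. (ii) The actions in (i) generate (by restriction) Poisson group actions of the Poisson Lie subgroups $G,G^*\subset D$: $$G\times D_\sigma\stackrel{L}{\to}D_\sigma,\qquad D_\sigma\times G\stackrel{R}{\to}D_\sigma,\qquad G^*\times D_\sigma\stackrel{L}{\to}D_\sigma,\qquad D_\sigma\times G^*\stackrel{R}{\to}D_\sigma.$$ (iii) The restrictions of the four actions in (ii) to the principal symplectic leaf $D'_\sigma$ possess moment maps in the sense of Lu and Weinstein: $$\mu^L_G(d)=g^*,\qquad \mu^L_{G^*}(d)=h,\qquad \mu^R_G(d)=h^*,\qquad \mu^R_{G^*}(d)=g,$$ where $g,h\in G$ and $g^*,h^*\in G^*$ are given by the twisted factorizations $d=g\,(g^* )^T=h^*h^T$.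
   Context: Factorizable Lie bialgebra: $\mathfrak g$ is a Lie algebra with a fixed nondegenerate invariant scalar product $\langle\cdot,\cdot\rangle$ (used to identify $\mathfrak g^*\simeq\mathfrak g$), and $r\in\mathrm{End}\,\mathfrak g$ is skew-symmetric, satisfies $[rX,rY]-r([rX,Y]+[X,rY])=-[X,Y]$, and the bracket on $\mathfrak g^*\simeq\mathfrak g$ is $[X,Y]_*=\frac12([rX,Y]+[X,rY])$. Put $r_\pm=\frac12(r\pm\mathrm{id})$. $G$ is a Poisson Lie group with tangent Lie bialgebra $(\mathfrak g,\mathfrak g^* )$. The automorphism of $\mathfrak g$ induced by $\sigma$ is denoted by the same letter. Double: $\mathfrak d=\mathfrak g\oplus\mathfrak g$ with scalar product $\langle\langle(X,X'),(Y,Y')\rangle\rangle=\langle X,Y\rangle-\langle X',Y'\rangle$; $\mathfrak g$ is embedded by $X\mapsto(X,X)$ and $\mathfrak g^*$ by $X\mapsto(X_+,X_-)$, $X_\pm=r_\pm X$; $\mathfrak g$ and $\mathfrak g^*$ are paired by $\langle\langle\cdot,\cdot\rangle\rangle$. $G\subset D=G\times G$ is the diagonal subgroup and $G^*\subset D$ the subgroup with Lie algebra $\mathfrak g^*\subset\mathfrak d$. $T=\sigma^{-1}\times\mathrm{id}$ on $\mathfrak d$ and $D$; $d^T=T(d)$. Gradients of $\varphi\in C^\infty(D)$: $\langle\langle\nabla\varphi(x),\xi\rangle\rangle=\frac{d}{dt}|_{t=0}\varphi(e^{t\xi}x)$, $\langle\langle\nabla'\varphi(x),\xi\rangle\rangle=\frac{d}{dt}|_{t=0}\varphi(xe^{t\xi})$,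 $\xi\in\mathfrak d$. Let $r_{\mathfrak d}=\begin{pmatrix}r&-2r_+\\2r_-&-r\end{pmatrix}$ and ${}^\sigma r_{\mathfrak d}=Tr_{\mathfrak d}T^{-1}$. The Poisson Lie group $D$ carries the bracket $\{\varphi,\psi\}=-\frac12\langle\langle r_{\mathfrak d}\nabla\varphi,\nabla\psi\rangle\rangle+\frac12\langle\langle r_{\mathfrak d}\nabla'\varphi,\nabla'\psi\rangle\rangle$, and $G,G^*\subset D$ are Poisson Lie subgroups. The twisted Heisenberg double $D_\sigma$ is the manifold $D$ with the bracket $\{\varphi,\psi\}_\sigma=\frac12\langle\langle r_{\mathfrak d}\nabla\varphi,\nabla\psi\rangle\rangle+\frac12\langle\langle{}^\sigma r_{\mathfrak d}\nabla'\varphi,\nabla'\psi\rangle\rangle$. The principal symplectic leaf $D'_\sigma\subset D_\sigma$ is the open dense subset of elements admitting the factorizations $d=g(g^* )^T=h^*h^T$; the Poisson structure is nondegenerate there, with symplectic form $\Omega$. A Poisson group action of a Poisson Lie group $A$ on a Poisson manifold $M$ is an action whose action map $A\times M\to M$ (or $M\times A\to M$) is Poisson for the product Poisson structure. Moment map in the sense of Lu and Weinstein: for $X\in\mathfrak a=\mathrm{Lie}(A)$ let $\widehat X$ be the vector field on $M$ generated by $X$. A map $\mu:M\to A^*$ into the dual Poisson Lie group is a moment map if, for all $X\in\mathfrak a$, $\widehat X$ is the image of a one-form under the Poisson tensor of $M$: of $-\langle\mu^*\theta,X\rangle$ for a right action, with $\theta$ the right-invariant Maurer--Cartan form on $A^*$,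 and of $\langle\mu^*\theta,X\rangle$ for a left action, with $\theta$ the left-invariant Maurer--Cartan form. For a right action on a symplectic $M$ the condition reads $\Omega(\widehat X,\cdot)=-\langle\mu^*(\theta),X\rangle$.
   Formalization: Left actions are Poisson for the opposite bracket on D, G, G* (the given sign fails); in (iii) the pairing of g with g* carries the sign making A* dual to A; factorization maps, not unique in general, are any smooth branches on an open part of D'_σ; the scalar product is Ad G-invariant. *)

(* Defs.v *)
From HB Require Import structures.
From mathcomp Require Import all_boot all_order all_algebra.
From mathcomp Require Import all_classical all_reals all_analysis.
Export Order.TTheory GRing.Theory Num.Theory.
Export numFieldNormedType.Exports.

#[export] Set Implicit Arguments.
#[export] Unset Strict Implicit.
#[export] Unset Printing Implicit Defensive.

Local Open Scope classical_set_scope.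
Local Open Scope ring_scope.

(* [f] is of class C^k on [U]; only meaningful for open [U]. *)
Fixpoint Ck (R : realType) (V W : normedModType R) (k : nat) (U : set V)
    (f : V -> W) : Prop :=
  match k with
  | 0 => forall x, U x -> {for x, continuous f}
  | k'.+1 => (forall x, U x -> differentiable f x) /\
             forall v, Ck k' U ('D_v f)
  end.

(* [chart_fun] and [chart_inv] are total functions; their values outside
   [chart_dom] and [chart_img] are irrelevant. *)
Record chart (R : realType) (M : topologicalType) (n : nat) := Chart {
  chart_dom : set M;
  chart_fun :> M -> 'rV[R]_n;
  chart_inv : 'rV[R]_n -> M }.

Definition chart_img (R : realType) (M : topologicalType) (n : nat)
  (c : chart R M n) : set 'rV[R]_n := c @` chart_dom c.

Definition is_chart (R : realType) (M : topologicalType) (n : nat)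
    (c : chart R M n) : Prop :=
  [/\ open (chart_dom c),
      open (chart_img c),
      forall x, chart_dom c x -> chart_inv c (c x) = x,
      forall x, chart_dom c x -> {for x, continuous c} &
      forall v, chart_img c v -> {for v, continuous (chart_inv c)}].

Definition atlas (R : realType) (M : topologicalType) (n : nat) :=
  set (chart R M n).

Definition smooth_on (R : realType) (M : topologicalType) (n : nat)
    (a : atlas R M n) (W : normedModType R) (U : set M) (f : M -> W) : Prop :=
  forall c, a c -> forall k,
    Ck k (c @` (chart_dom c `&` U)) (f \o chart_inv c).

(* Smoothness in charts of the target; only meaningful for open [U]. *)
Definition smooth_map_on (R : realType) (M N : topologicalType) (m n : nat)
    (a : atlas R M m) (b : atlas R N n) (U : set M) (f : M -> N) : Prop :=
  (forall x, U x -> {for x, continuous f}) /\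
  forall c, b c -> smooth_on a (U `&` f @^-1` chart_dom c) (c \o f).

(* The last clause says that the transition maps are C^oo. *)
Definition is_manifold (R : realType) (M : topologicalType) (n : nat)
    (a : atlas R M n) : Prop :=
  [/\ hausdorff_space M,
      @second_countable M,
      forall c, a c -> is_chart c,
      forall x, exists2 c, a c & chart_dom c x &
      forall c, a c -> smooth_on a (chart_dom c) c].

Definition prod_chart (R : realType) (M N : topologicalType) (m n : nat)
    (c : chart R M m) (c' : chart R N n) : chart R (M * N)%type (m + n) :=
  Chart (chart_dom c `*` chart_dom c')
        (fun p => row_mx (c p.1) (c' p.2))
        (fun v => (chart_inv c (lsubmx v), chart_inv c' (rsubmx v))).

Definition prod_atlas (R : realType) (M N : topologicalType) (m n : nat)
    (a : atlas R M m) (b : atlas R N n) : atlas R (M * N)%type (m + n) :=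
  [set k | exists c c', [/\ a c, b c' & k = prod_chart c c']].

(* Two curves have the same tangent vector at parameter [0]. *)
Definition same_velocity (R : realType) (M : topologicalType) (n : nat)
    (a : atlas R M n) (p q : R -> M) : Prop :=
  [/\ p 0 = q 0,
      {for 0, continuous p},
      {for 0, continuous q} &
      forall c, a c -> chart_dom c (p 0) ->
        [/\ derivable (c \o p) 0 1, derivable (c \o q) 0 1 &
            derive1 (c \o p) 0 = derive1 (c \o q) 0]].

#[short(type="topGroupType")]
HB.structure Definition TopGroup := {G of Topological G & Group G}.

HB.instance Definition _ (G H : topGroupType) :=
  Topological.on (G * H)%type.

Record lieGroup (R : realType) := LieGroup {
  lie_sort :> topGroupType;
  lie_dim : nat;
  lie_atlas : atlas R lie_sort lie_dim;
  lie_manifold : is_manifold lie_atlas;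
  lie_mul : smooth_map_on (prod_atlas lie_atlas lie_atlas) lie_atlas setT
              (fun p : lie_sort * lie_sort => (p.1 * p.2)%g);
  lie_inv : smooth_map_on lie_atlas lie_atlas setT (fun x => x^-1%g) }.

Arguments lie_dim {R} l.
Arguments lie_atlas {R} l.

(* The vector space [g], with bracket [br], is the Lie algebra of [G], and
   [ex] is its exponential map: [X |-> d/dt ex(tX) at t = 0] identifies [g]
   with the tangent space at 1 and [br] with the commutator of left-invariant
   vector fields [phi |-> (x |-> d/dt phi(x ex(tX)) at t = 0)]. *)
Record is_lie_exp (R : realType) (G : lieGroup R) (g : vectType R)
    (br : g -> g -> g) (ex : g -> G) : Prop := IsLieExp {
  exp_oneparam : forall (s t : R) X,
    ex ((s + t) *: X) = (ex (s *: X) * ex (t *: X))%g;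
  exp_cont : forall X, {for 0, continuous (fun t : R => ex (t *: X))};
  exp_tangent : forall c, lie_atlas G c -> chart_dom c 1%g ->
    exists L : g -> 'rV[R]_(lie_dim G), [/\ linear L, bijective L &
      forall X, is_derive (0 : R) 1 (fun t : R => c (ex (t *: X))) (L X)];
  exp_bracket : forall (U : set G) (phi : G -> R),
    open U -> smooth_on (lie_atlas G) U phi ->
    let lieD X (psi : G -> R) x :=
      derive1 (fun t : R => psi (x * ex (t *: X))%g) 0 in
    forall X Y x, U x ->
      lieD X (lieD Y phi) x - lieD Y (lieD X phi) x = lieD (br X Y) phi x }.

Record is_lie_automorphism (R : realType) (G : lieGroup R) (f f' : G -> G) :
    Prop := IsLieAutomorphism {
  aut_morph : {morph f : x y / (x * y)%g};
  aut_fK : cancel f f';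
  aut_Kf : cancel f' f;
  aut_smooth : smooth_map_on (lie_atlas G) (lie_atlas G) setT f;
  aut_inv_smooth : smooth_map_on (lie_atlas G) (lie_atlas G) setT f' }.

Record factLieBialgebra (R : realType) := FactLieBialgebra {
  flb :> vectType R;
  flb_br : flb -> flb -> flb;
  flb_sp : flb -> flb -> R;
  flb_r : 'End(flb);
  br_linearl : forall Y, linear (flb_br ^~ Y);
  br_linearr : forall X, linear (flb_br X);
  br_alt : forall X, flb_br X X = 0;
  br_jacobi : forall X Y Z,
    flb_br X (flb_br Y Z) + flb_br Y (flb_br Z X) + flb_br Z (flb_br X Y) = 0;
  sp_linear : forall X, scalar (flb_sp X);
  sp_sym : forall X Y, flb_sp X Y = flb_sp Y X;
  sp_nondeg : forall X, (forall Y, flb_sp X Y = 0) -> X = 0;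
  sp_inv : forall X Y Z, flb_sp (flb_br X Y) Z = flb_sp X (flb_br Y Z);
  r_skew : forall X Y, flb_sp (flb_r X) Y = - flb_sp X (flb_r Y);
  r_mcybe : forall X Y,
    flb_br (flb_r X) (flb_r Y)
      - flb_r (flb_br (flb_r X) Y + flb_br X (flb_r Y)) = - flb_br X Y }.

Section Double.
Context {R : realType} (g : factLieBialgebra R).
Local Notation r := (flb_r g).
Local Notation sp := (@flb_sp R g).
Local Notation br := (@flb_br R g).
Local Notation d := (g * g)%type.
Implicit Types (X Y : g) (xi eta u v : d).

Definition br_star X Y : g := 2^-1 *: (br (r X) Y + br X (r Y)).

Definition r_plus : 'End(g) := 2^-1 *: (r + \1%VF).
Definition r_minus : 'End(g) := 2^-1 *: (r - \1%VF).

Definition spd xi eta : R := sp xi.1 eta.1 - sp xi.2 eta.2.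
Definition brd xi eta : d := (br xi.1 eta.1, br xi.2 eta.2).

(* The embeddings of [g] and of its dual (identified with [g] by [sp]). *)
Definition emb_g X : d := (X, X).
Definition emb_gs X : d := (r_plus X, r_minus X).

Definition rd xi : d :=
  (r xi.1 - 2 *: r_plus xi.2, 2 *: r_minus xi.1 - r xi.2).

(* [r_d] conjugated by [T = s^-1 x id]. *)
Definition rd_twisted (s : 'End(g)) xi : d :=
  let z := rd (s xi.1, xi.2) in ((s^-1)%VF z.1, z.2).

(* Let [A] be a Lie subgroup of the double with Lie algebra [j : a -> d],
   carrying [eps] times the restriction of the Poisson bracket of the double.
   For functions on the double with gradients [u], [v] at 1, the derivative at
   1 of their bracket is the linear form [<<([rd u, v] + [u, rd v])/2, .>>].
   So [dual_pairing eps j brb kap] says that, for the pairing [kap] of [b] with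
   [a], the bracket [brb] is the one that [A] induces on the dual of its Lie
   algebra, i.e. that [b] is the Lie algebra of the dual Poisson Lie group. *)
Definition dual_pairing (a b : vectType R) (eps : R) (j : a -> d)
    (brb : b -> b -> b) (kap : b -> a -> R) : Prop :=
  [/\ (forall x : b, (forall X : a, kap x X = 0) -> x = 0),
      (forall X : a, (forall x : b, kap x X = 0) -> X = 0) &
      forall (x y : b) u v,
        (forall X : a, spd u (j X) = kap x X) ->
        (forall X : a, spd v (j X) = kap y X) ->
        forall X : a, kap (brb x y) X
          = eps * spd (2^-1 *: (brd (rd u) v + brd u (rd v))) (j X)].

End Double.

(* A covector at a point [x] is represented by its values on (the tangent
   vectors of) the curves through [x]. *)
Definition covector (R : realType) (M : Type) := (R -> M) -> R.

Definition dfun (R : realType) (M : Type) (phi : M -> R) : covector R M :=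
  fun c => derive1 (phi \o c) 0.

Definition pbracket (R : realType) (M : Type) :=
  (M -> R) -> (M -> R) -> M -> R.

Definition opp_bracket (R : realType) (M : Type) (b : pbracket R M) :
  pbracket R M := fun phi psi x => - b phi psi x.

Definition prod_bracket (R : realType) (M N : Type)
    (bM : pbracket R M) (bN : pbracket R N) : pbracket R (M * N) :=
  fun phi psi p =>
    bM (fun x => phi (x, p.2)) (fun x => psi (x, p.2)) p.1
    + bN (fun y => phi (p.1, y)) (fun y => psi (p.1, y)) p.2.

Record is_poisson_bracket (R : realType) (M : topologicalType) (n : nat)
    (a : atlas R M n) (b : pbracket R M) : Prop := IsPoissonBracket {
  pb_smooth : forall phi psi : M -> R, smooth_on a setT phi ->
    smooth_on a setT psi -> smooth_on a setT (b phi psi);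
  pb_linear : forall (k : R) (phi psi chi : M -> R), smooth_on a setT phi ->
    smooth_on a setT psi -> smooth_on a setT chi -> forall x,
    b (fun y => k * phi y + psi y) chi x = k * b phi chi x + b psi chi x;
  pb_skew : forall phi psi : M -> R, smooth_on a setT phi ->
    smooth_on a setT psi -> forall x, b phi psi x = - b psi phi x;
  pb_leibniz : forall phi psi chi : M -> R, smooth_on a setT phi ->
    smooth_on a setT psi -> smooth_on a setT chi -> forall x,
    b (fun y => phi y * psi y) chi x = phi x * b psi chi x + psi x * b phi chi x;
  pb_jacobi : forall phi psi chi : M -> R, smooth_on a setT phi ->
    smooth_on a setT psi -> smooth_on a setT chi -> forall x,
    b phi (b psi chi) x + b psi (b chi phi) x + b chi (b phi psi) x = 0 }.

Definition is_poisson_map (R : realType) (M N : topologicalType) (m n : nat)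
    (aM : atlas R M m) (aN : atlas R N n)
    (bM : pbracket R M) (bN : pbracket R N) (f : M -> N) : Prop :=
  smooth_map_on aM aN setT f /\
  forall phi psi : N -> R, smooth_on aN setT phi -> smooth_on aN setT psi ->
    forall x, bM (phi \o f) (psi \o f) x = bN phi psi (f x).

(* The bracket [bA] makes the Lie subgroup [i : A -> D] a Poisson subgroup of
   [(D, bD)]. *)
Definition is_poisson_subgroup (R : realType) (A D : topGroupType) (m n : nat)
    (aA : atlas R A m) (aD : atlas R D n)
    (bA : pbracket R A) (bD : pbracket R D) (i : A -> D) : Prop :=
  [/\ {morph i : x y / (x * y)%g}, injective i, is_poisson_bracket aA bA &
      is_poisson_map aA aD bA bD i].

(* The bracket of the acting group is an explicit argument: inversion on a
   Poisson Lie group is anti-Poisson, so turning a Poisson right action of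
   [(A, bA)] into a left action through [a |-> a^-1] gives a Poisson left action
   of [(A, opp_bracket bA)]. *)
Definition left_poisson_action (R : realType) (A : topGroupType)
    (M : topologicalType) (m n : nat) (aA : atlas R A m) (aM : atlas R M n)
    (bA : pbracket R A) (bM : pbracket R M) (act : A * M -> M) : Prop :=
  [/\ forall x, act (1%g, x) = x,
      forall a b x, act ((a * b)%g, x) = act (a, act (b, x)) &
      is_poisson_map (prod_atlas aA aM) aM (prod_bracket bA bM) bM act].

Definition right_poisson_action (R : realType) (A : topGroupType)
    (M : topologicalType) (m n : nat) (aA : atlas R A m) (aM : atlas R M n)
    (bA : pbracket R A) (bM : pbracket R M) (act : M * A -> M) : Prop :=
  [/\ forall x, act (x, 1%g) = x,
      forall a b x, act (x, (a * b)%g) = act (act (x, a), b) &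
      is_poisson_map (prod_atlas aM aA) aM (prod_bracket bM bA) bM act].

(* Left- and right-invariant Maurer-Cartan forms on the velocity of [c] at 0. *)
Definition mc_left (R : realType) (G : lieGroup R) (g : vectType R)
    (ex : g -> G) (c : R -> G) : g :=
  xget 0 [set X | same_velocity (lie_atlas G)
                    (fun t => ((c 0%R)^-1 * c t)%g) (fun t => ex (t *: X))].

Definition mc_right (R : realType) (G : lieGroup R) (g : vectType R)
    (ex : g -> G) (c : R -> G) : g :=
  xget 0 [set X | same_velocity (lie_atlas G)
                    (fun t => (c t * (c 0%R)^-1)%g) (fun t => ex (t *: X))].

(* [pi x] is the Poisson tensor at [x], with [{phi, psi} = pi (dphi, dpsi)].
   The image of a one-form [al] is the vector field [phi |-> pi (dphi, al)].
   [S] is the dual of the acting group, with Lie algebra [b], and [kap] is the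
   pairing of [b] with the Lie algebra [a] of the acting group. *)
Definition left_moment_map (R : realType) (M : topologicalType) (n : nat)
    (aM : atlas R M n) (pi : M -> covector R M -> covector R M -> R)
    (U : set M) (A S : lieGroup R) (a b : vectType R)
    (exA : a -> A) (exS : b -> S) (kap : b -> a -> R)
    (act : A * M -> M) (mu : M -> S) : Prop :=
  smooth_map_on aM (lie_atlas S) U mu /\
  forall X (phi : M -> R), smooth_on aM U phi -> forall x, U x ->
    dfun phi (fun t : R => act (exA (t *: X), x))
    = pi x (dfun phi) (fun c => kap (mc_left exS (mu \o c)) X).

Definition right_moment_map (R : realType) (M : topologicalType) (n : nat)
    (aM : atlas R M n) (pi : M -> covector R M -> covector R M -> R)
    (U : set M) (A S : lieGroup R) (a b : vectType R)
    (exA : a -> A) (exS : b -> S) (kap : b -> a -> R)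
    (act : M * A -> M) (mu : M -> S) : Prop :=
  smooth_map_on aM (lie_atlas S) U mu /\
  forall X (phi : M -> R), smooth_on aM U phi -> forall x, U x ->
    dfun phi (fun t : R => act (x, exA (t *: X)))
    = pi x (dfun phi) (fun c => - kap (mc_right exS (mu \o c)) X).

Section HeisenbergDouble.
Context {R : realType} (g : factLieBialgebra R) (G : lieGroup R) (ex : g -> G).
Local Notation d := (g * g)%type.
Local Notation D := (G * G)%type.
Implicit Types (x : D) (xi : d) (al be : covector R D).

Definition double_atlas : atlas R D _ := prod_atlas (lie_atlas G) (lie_atlas G).

Definition exd xi : D := (ex xi.1, ex xi.2).

(* [grad (dfun phi) x] and [grad' (dfun phi) x] are the left and right
   gradients of [phi] at [x]. *)
Definition grad al x : d :=
  xget 0 [set u | forall xi, spd u xi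
                  = al (fun t : R => (exd (t *: xi) * x)%g)].
Definition grad' al x : d :=
  xget 0 [set u | forall xi, spd u xi
                  = al (fun t : R => (x * exd (t *: xi))%g)].

Definition pi_double x al be : R :=
  - (2^-1 * spd (rd (grad al x)) (grad be x))
  + 2^-1 * spd (rd (grad' al x)) (grad' be x).

Definition pi_twisted (s : 'End(g)) x al be : R :=
  2^-1 * spd (rd (grad al x)) (grad be x)
  + 2^-1 * spd (rd_twisted s (grad' al x)) (grad' be x).

Definition br_double : pbracket R D :=
  fun phi psi x => pi_double x (dfun phi) (dfun psi).
Definition br_twisted (s : 'End(g)) : pbracket R D :=
  fun phi psi x => pi_twisted s x (dfun phi) (dfun psi).

Definition Ad_invariant : Prop :=
  forall (x : G) (X Y X' Y' : g),
    same_velocity (lie_atlas G) (fun t : R => (x * ex (t *: X) * x^-1)%g)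
                                (fun t : R => ex (t *: X')) ->
    same_velocity (lie_atlas G) (fun t : R => (x * ex (t *: Y) * x^-1)%g)
                                (fun t : R => ex (t *: Y')) ->
    flb_sp X' Y' = flb_sp X Y.

Definition diagD (x : G) : D := (x, x).

(* [i : S -> D] is the subgroup of [D] with Lie algebra [emb_gs]; [i] need not
   be a topological embedding. *)
Record is_dual_subgroup (S : lieGroup R) (exS : g -> S) (i : S -> D) : Prop :=
  IsDualSubgroup {
  ds_exp : is_lie_exp (@br_star R g) exS;
  ds_morph : {morph i : x y / (x * y)%g};
  ds_inj : injective i;
  ds_smooth : smooth_map_on (lie_atlas S) double_atlas setT i;
  ds_tangent : forall X, i (exS X) = exd (emb_gs X) }.

(* [T = sigma^-1 x id] on [D]; the argument [sigma'] stands for [sigma^-1]. *)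
Definition twist (sigma' : G -> G) x : D := (sigma' x.1, x.2).

Definition actL (sigma' : G -> G) (p : D * D) : D :=
  (p.2 * (twist sigma' p.1)^-1)%g.
Definition actR (p : D * D) : D := (p.2^-1 * p.1)%g.

Definition principal_leaf (sigma' : G -> G) (S : lieGroup R) (i : S -> D) :
    set D :=
  [set x | (exists a b, x = (diagD a * twist sigma' (i b))%g) /\
           (exists b a, x = (i b * twist sigma' (diagD a))%g)].

End HeisenbergDouble.

Arguments double_atlas {R} G.

(* Main.v *)
Require Import Defs.
From HB Require Import structures.
From mathcomp Require Import all_boot all_order all_algebra.
From mathcomp Require Import all_classical all_reals all_analysis.
From mathcomp Require Import ring.
Local Open Scope classical_set_scope.
Local Open Scope ring_scope.

(** Both Poisson tensors are built from the gradients of the functions, so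
    everything is a first-order computation at a point of the double [D]; below,
    [T] is the twist and [<<, >>] the invariant scalar product [spd].

    Actions. The adjoint action of [D] preserves [<<, >>] and exchanges the two
    gradients ([grad_Ad]). Let [y = x k] with [k = (T b)^-1], the result of the
    left action of [b] on [x]. As a function of [x], [phi (x k)] has left
    gradient [grad phi y] and right gradient [Ad k (grad' phi y)]; as a function
    of [b], it has left gradient [- T^-1 (grad' phi y)] and right gradient
    [- T^-1 (Ad k (grad' phi y))]. In the sum of the twisted bracket in [x] and
    of the opposite of the bracket of [D] in [b], the terms moved by [Ad k]
    cancel and the others form the twisted bracket at [y] ([actL_bracket]); the
    right action is similar ([actR_bracket]). For a Poisson subgroup of [D] the
    same identity is restricted along the inclusion, which is a Poisson map.

    Dual pairings. The diagonal and the image of the dual algebra in the double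
    are isotropic, and the linear map [rd] is -1 on the first and 1 on the
    second. That each is the dual of the other as a Lie bialgebra is linear
    algebra; the modified Yang-Baxter equation is what makes the bracket induced
    by the second one that of [g] ([dual_pairing_gs]).

    Moment maps. Let [j1] and [j2] be these two subalgebras, in any order, and
    let [e] be the eigenvalue of [rd] on [j1]. Suppose that [x = f1(a) T f2(b)]
    smoothly on an open set, and put [k = T f2(b)]. Differentiation shows that
    each vector of the double is the sum of an element of [Ad k^-1 j1] and of
    the image under [T j2] of the Maurer-Cartan component of [b] along it
    ([left_factor_velocity]). Split [e T j1 X = u + T j2 W] in this way. The two
    summands are isotropic, hence [u] is the right gradient of the one-form
    given by that component paired with [X]. The corresponding left gradient
    [Ad x u] lies in [j1], where [rd] is [e], and the twisted [rd] maps
    [u = T (e j1 X - j2 W)] to [T (j1 X + e j2 W)]. The Poisson tensor applied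
    to [phi] and this one-form is thus [- <<grad' phi, T j1 X>>], the derivative
    of [phi] along the action of [X] ([left_moment_map_factor]). Exchanging the
    sides gives the right actions ([right_moment_map_factor]).

    Gradients, [Ad] and Maurer-Cartan components are all determined by
    velocities of curves, so the analysis consists of a chain rule in charts
    ([is_derive_chart], [same_velocity_comp]) and a product rule for curves in a
    group ([has_velM]). *)

(** * Calculus of functions of class C^k *)

Section CkBasics.
Context {R : realType}.
Implicit Types (V W : normedModType R).

(** The difference of the two functions vanishes near [x], hence is a little-o
    there: it is differentiable with differential 0. *)
Lemma near_eq_differentiable V W (f g : V -> W) (x : V) :
  (\near x, f x = g x) -> differentiable f x -> differentiable g x.
Proof.
move=> fg df; rewrite -[g](addrNK f); apply: differentiableD => //.
pose h : V -> W := g - f.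
have eqh : h \o shift x = cst (h x) + (\0 : V -> W) +o_ 0 id.
  apply/eqaddoP => _/posnumP[e].
  have h0 : h x = 0 by rewrite /h [LHS](_ : _ = g x - f x)// (nbhs_singleton fg) subrr.
  have : \forall y \near x, h y = 0.
    by near=> y; rewrite /h [LHS](_ : _ = g y - f y)// (near fg y) ?subrr.
  rewrite (near_shift 0) /= subr0 => hn.
  near=> y; rewrite !fctE /= h0 addr0 subr0.
  have -> : h (y + x) = 0 by near: y.
  by rewrite normr0 mulr_ge0.
apply/diff_locallyP.
have -> : 'd h x = \0 :> (V -> W) by apply: diff_unique eqh => y; exact: cvg_cst.
by split; [move=> ?; exact: cvg_cst|exact: eqh].
Unshelve. all: by end_near. Qed.

Lemma Ck_sub V W k (U O : set V) (f : V -> W) :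
  O `<=` U -> Ck k U f -> Ck k O f.
Proof.
elim: k f => [|k IH] f OU /=; first by move=> h x /OU /h.
by case=> h1 h2; split=> [x /OU /h1//|v]; exact: IH.
Qed.

Lemma open_near_eq V W (U : set V) (f g : V -> W) x :
  open U -> U x -> (forall x, U x -> f x = g x) -> \near x, f x = g x.
Proof.
by move=> oU Ux fg; near=> y; apply: fg; near: y; exact: open_nbhs_nbhs.
Unshelve. all: by end_near. Qed.

Lemma Ck_ext V W k (U : set V) (f g : V -> W) :
  open U -> (forall x, U x -> f x = g x) -> Ck k U f -> Ck k U g.
Proof.
move=> oU; elim: k f g => [|k IH] f g fg /=.
  move=> h x Ux; rewrite /prop_for /continuous_at -(fg _ Ux).
  apply: cvg_trans (h x Ux); apply: near_eq_cvg.
  exact: open_near_eq fg.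
case=> h1 h2; split=> [x Ux|v].
  by apply: near_eq_differentiable (h1 x Ux); exact: open_near_eq fg.
apply: IH (h2 v) => x Ux.
by apply: near_eq_derive; exact: open_near_eq fg.
Qed.

(** [U] is covered by sets on each of which [f] is of class C^k; together with
    [Ck_ext] this lets functions be compared on neighbourhoods only. *)
Lemma Ck_local V W k (U : set V) (f : V -> W) :
  (forall x, U x -> exists2 O, O x & Ck k O f) -> Ck k U f.
Proof.
elim: k f => [|k IH] f h /=.
  by move=> x /h [ O Ox]; apply.
split=> [x /h [ O Ox [+ _]]|v]; first by apply.
by apply: IH => x /h [ O Ox [_ hv]]; exists O; last exact: hv.
Qed.

Lemma CkS V W k (U : set V) (f : V -> W) : Ck k.+1 U f -> Ck k U f.
Proof.
elim: k f => [|k IH] f /= [h1 h2].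
  by move=> x Ux; exact/differentiable_continuous/h1.
by split=> // v; exact/IH/h2.
Qed.

Lemma Ck_continuous V W k (U : set V) (f : V -> W) x :
  Ck k U f -> U x -> {for x, continuous f}.
Proof. by elim: k => [|k IH] => [|/CkS]; [apply|exact: IH]. Qed.

Lemma Ck_cst V W k (U : set V) (w : W) : Ck k U (cst w : V -> W).
Proof.
elim: k w => [|k IH] w /=; first by move=> x _; exact: cvg_cst.
split=> [x _|v]; first exact: differentiable_cst.
have -> : 'D_v (cst w : V -> W) = cst 0 by apply/funext => x; rewrite derive_cst.
exact: IH.
Qed.

Lemma Ck_id V k (U : set V) : Ck k U (@id V).
Proof.
case: k => [|k] /=; first by move=> x _; exact: cvg_id.
split=> [x _|v]; first exact: ex_diff.
have -> : 'D_v (@id V) = cst v by apply/funext => x; rewrite derive_id.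
exact: Ck_cst.
Qed.

Lemma Ck_lin V W W' (l : {linear W -> W'}) k (U : set V) (f : V -> W) :
  continuous l -> open U -> Ck k U f -> Ck k U (l \o f).
Proof.
move=> cl oU; elim: k f => [|k IH] f /=.
  by move=> h x Ux; apply: continuous_comp; [exact: h|exact: cl].
case=> h1 h2; split=> [x Ux|v].
  by apply: differentiable_comp; [exact: h1|exact: linear_differentiable].
apply: (@Ck_ext _ _ _ _ (l \o 'D_v f)); rewrite //; last exact: IH.
move=> x Ux; have df := h1 x Ux.
rewrite /= [RHS]deriveE; last first.
  by apply: differentiable_comp => //; exact: linear_differentiable.
rewrite diff_comp//; last exact: linear_differentiable.
by rewrite /= diff_lin// deriveE.
Qed.

Lemma Ck_add V W k (U : set V) (f g : V -> W) :
  open U -> Ck k U f -> Ck k U g -> Ck k U (f + g).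
Proof.
move=> oU; elim: k f g => [|k IH] f g /=.
  by move=> hf hg x Ux; apply: continuousD; [exact: hf|exact: hg].
move=> [f1 f2] [g1 g2]; split=> [x Ux|v].
  by apply: differentiableD; [exact: f1|exact: g1].
apply: (@Ck_ext _ _ _ _ ('D_v f + 'D_v g)); rewrite //; last exact: IH.
by move=> x Ux; rewrite [RHS]deriveD//; apply: diff_derivable; auto.
Qed.

Lemma Ck_sum V W k (U : set V) n (f : 'I_n -> V -> W) :
  open U -> (forall i, Ck k U (f i)) -> Ck k U (\sum_i f i).
Proof.
move=> oU h; elim/big_ind: _ => //; first exact: (@Ck_cst V W k U 0).
by move=> *; exact: Ck_add.
Qed.

(** The product rule for a scalar function times a vector-valued one comes from
    the differential of the bilinear map [scale], composed with a pair. *)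
Lemma scale_is_bilinear W :
  bilinear_for
    (GRing.Scale.Law.clone _ _ *:%R _) (GRing.Scale.Law.clone _ _ *:%R _)
    (@GRing.scale R W).
Proof.
split=> [w|r] a x y /=; first by rewrite scalerDl scalerA.
by rewrite scalerDr !scalerA mulrC.
Qed.

HB.instance Definition _ W := bilinear_isBilinear.Build R R W W _ _
  (@GRing.scale R W) (scale_is_bilinear W).

Lemma is_diff_scale V W (k dk : V -> R) (f df : V -> W) x :
  is_diff x k dk -> is_diff x f df ->
  is_diff x (fun y => k y *: f y) (fun y => k x *: df y + dk y *: f x).
Proof.
move=> dkx dfx.
have cs : continuous (fun p : R * W => p.1 *: p.2) by move=> p; exact: scale_continuous.
have ds p : is_diff p (fun p : R * W => p.1 *: p.2)
    (fun q => p.1 *: q.2 + q.1 *: p.2).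
  by apply: DiffDef; [exact: differentiable_bilin|rewrite diff_bilin].
have := is_diff_comp (is_diff_pair dkx dfx) (ds (k x, f x)).
by apply.
Qed.

Lemma Ck_scale V W k (U : set V) (c : V -> R) (f : V -> W) :
  open U -> Ck k U c -> Ck k U f -> Ck k U (fun x => c x *: f x).
Proof.
move=> oU; elim: k c f => [|k IH] c f.
  by move=> hc hf x Ux; apply: continuousZ; [exact: hc|exact: hf].
move=> Cc Cf; have c0 := CkS Cc; have f0 := CkS Cf.
move: Cc Cf => [c1 c2] [f1 f2].
have dcf x : U x -> is_diff x (fun x => c x *: f x)
    (fun y => c x *: 'd f x y + 'd c x y *: f x).
  by move=> Ux; apply: is_diff_scale; apply/differentiableP; [exact: c1|exact: f1].
split=> [x Ux|v]; first by have [] := dcf x Ux.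
apply: (@Ck_ext _ _ _ _
  ((fun x => c x *: 'D_v f x) + (fun x => 'D_v c x *: f x))) => //.
  move=> x Ux; have [d1 d2] := dcf x Ux.
  by rewrite [RHS]deriveE// d2 [LHS](_ : _ = c x *: 'D_v f x + 'D_v c x *: f x)//
             !deriveE//; [exact: c1|exact: f1].
by apply: Ck_add => //; apply: IH => //; [exact: f2|exact: c2].
Qed.

(** A row vector is the sum of its coordinates times the constant vectors
    [delta_mx 0 j], so that scalar functions decide its class. *)
Lemma Ck_coord V n k (U : set V) (f : V -> 'rV[R]_n) :
  open U -> Ck k U f <-> forall j, Ck k U (fun x => f x 0 j).
Proof.
move=> oU; split=> [Cf j|Cf].
  have @l : {linear 'rV[R]_n -> R}.
    by exists (fun N : 'rV[R]_n => N 0 j); do 2![eexists]; do ?[constructor];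
     rewrite ?mxE// => ? *; rewrite ?mxE//; move=> ?; rewrite !mxE.
  by apply: (@Ck_lin _ _ _ l) => //; exact: coord_continuous.
have -> : f = \sum_j (fun x => f x 0 j *: delta_mx 0 j).
  by apply/funext => x; rewrite fct_sumE [LHS]row_sum_delta.
apply: Ck_sum => // j.
have sx_lin : linear ( *:%R ^~ (delta_mx 0 j) : R -> 'rV[R]_n).
  by move=> u y z; rewrite scalerDl scalerA.
pose sxL : {linear R -> 'rV[R]_n} :=
  HB.pack ( *:%R ^~ (delta_mx 0 j : 'rV[R]_n)) (GRing.isLinear.Build _ _ _ _ _ sx_lin).
by apply: (@Ck_lin _ _ _ sxL) => //; exact: scalel_continuous.
Qed.

Lemma Ck_row_mx V m n k (U : set V) (f : V -> 'rV[R]_m) (g : V -> 'rV[R]_n) :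
  open U -> Ck k U f -> Ck k U g -> Ck k U (fun x => row_mx (f x) (g x)).
Proof.
move=> oU /Ck_coord Cf /Ck_coord Cg; apply/Ck_coord => // j.
case: (split_ordP j) => i ->.
  have -> : (fun x => row_mx (f x) (g x) 0 (lshift n i)) = (fun x => f x 0 i).
    by apply/funext => x; rewrite row_mxEl.
  exact: Cf.
have -> : (fun x => row_mx (f x) (g x) 0 (rshift m i)) = (fun x => g x 0 i).
  by apply/funext => x; rewrite row_mxEr.
exact: Cg.
Qed.

(** By induction on [k]: the derivative of [F \o G] along [v] is the sum over
    [j] of the [j]-th coordinate of ['D_v G] times [('D_(e_j) F) \o G]. The
    first factor is of class C^k by assumption, the second by induction. *)
Lemma Ck_comp V W n k (U : set V) (O : set 'rV[R]_n)
    (F : 'rV[R]_n -> W) (G : V -> 'rV[R]_n) :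
  open U -> open O -> (forall x, U x -> O (G x)) ->
  Ck k O F -> Ck k U G -> Ck k U (F \o G).
Proof.
move=> oU oO UO; elim: k F => [|k IH] F.
  move=> hF hG x Ux; apply: continuous_comp; first exact: hG.
  exact/hF/UO.
move=> CF CG; have G0 := CkS CG; move: CF CG => [F1 F2] [G1 G2].
split=> [x Ux|v]; first by apply: differentiable_comp; [exact: G1|exact/F1/UO].
apply: (@Ck_ext _ _ _ _
  (\sum_j (fun x => ('D_v G x) 0 j *: 'D_(delta_mx 0 j) F (G x)))) => //.
  move=> x Ux; have dG := G1 x Ux; have dF := F1 _ (UO _ Ux).
  rewrite fct_sumE [RHS]deriveE; last exact: differentiable_comp.
  rewrite diff_comp//= [in RHS](row_sum_delta ('d G x v)) linear_sum.
  by apply: eq_bigr => j _; rewrite linearZ /= !deriveE.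
apply: Ck_sum => // j; apply: Ck_scale => //; first last.
  by have := IH ('D_(delta_mx 0 j) F); apply; [exact: F2|].
by apply: (Ck_coord k ('D_v G) oU).1; exact: G2.
Qed.

End CkBasics.

(** The germ version of [Ck]: compositions no longer carry domains along. *)
Definition Ck_at (R : realType) (V W : normedModType R) k (f : V -> W) (v : V) :=
  exists2 O, open_nbhs v O & Ck k O f.

Section CkAt.
Context {R : realType}.
Implicit Types (V W : normedModType R).

Lemma Ck_at_on V W k (U : set V) (f : V -> W) : open U ->
  Ck k U f <-> forall v, U v -> Ck_at k f v.
Proof.
move=> oU; split=> [Cf v Uv|h]; first by exists U.
by apply: Ck_local => v /h [ O [oO Ov]]; exists O.
Qed.

Lemma Ck_at_ext V W k (f g : V -> W) v :
  (\near v, f v = g v) -> Ck_at k f v -> Ck_at k g v.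
Proof.
move=> fg [ O oO Cf].
have : nbhs v ([set x | f x = g x] `&` O).
  by apply: filterI => //; exact: open_nbhs_nbhs.
rewrite nbhsE => -[B oB BO]; exists B => //.
apply: (@Ck_ext _ _ _ _ _ f); [by case: oB|by move=> x /BO []|].
by apply: Ck_sub Cf => x /BO [].
Qed.

Lemma Ck_at_continuous V W k (f : V -> W) v :
  Ck_at k f v -> {for v, continuous f}.
Proof. by case=> O [_ Ov] Cf; exact: Ck_continuous Cf Ov. Qed.

Lemma Ck_at_differentiable V W k (f : V -> W) v :
  Ck_at k.+1 f v -> differentiable f v.
Proof. by case=> O [_ Ov] [+ _]; exact. Qed.

Lemma Ck_at_comp V W n k (F : 'rV[R]_n -> W) (G : V -> 'rV[R]_n) v :
  Ck_at k F (G v) -> Ck_at k G v -> Ck_at k (F \o G) v.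
Proof.
move=> [ O oO CF] CG; have cG := Ck_at_continuous CG.
have [B oB CB] := CG.
have : nbhs v (G @^-1` O `&` B).
  by apply: filterI; [apply: cG|]; exact: open_nbhs_nbhs.
rewrite nbhsE => -[C oC CO]; exists C => //.
apply: (@Ck_comp _ _ _ _ _ _ O) => //; [by case: oC|by case: oO| |].
  by move=> x /CO [].
by apply: Ck_sub CB => x /CO [].
Qed.

Lemma Ck_at_row_mx V m n k (f : V -> 'rV[R]_m) (g : V -> 'rV[R]_n) v :
  Ck_at k f v -> Ck_at k g v -> Ck_at k (fun x => row_mx (f x) (g x)) v.
Proof.
move=> [ O [oO Ov] Cf] [B [oB Bv] Cg]; exists (O `&` B).
  by split; [exact: openI|].
by apply: Ck_row_mx; [exact: openI|exact: Ck_sub Cf|exact: Ck_sub Cg].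
Qed.

Lemma Ck_at_cst V W k (w : W) v : Ck_at k (cst w : V -> W) v.
Proof. by exists setT; [split=> //; exact: openT|exact: Ck_cst]. Qed.

Lemma Ck_at_lsubmx m n k (v : 'rV[R]_(m + n)) :
  Ck_at k (lsubmx : 'rV[R]_(m + n) -> 'rV[R]_m) v.
Proof.
exists setT; first by split=> //; exact: openT.
apply: (@Ck_lin _ _ _ _ lsubmx k setT id); [exact: continuous_lsubmx|exact: openT|].
exact: Ck_id.
Qed.

Lemma Ck_at_rsubmx m n k (v : 'rV[R]_(m + n)) :
  Ck_at k (rsubmx : 'rV[R]_(m + n) -> 'rV[R]_n) v.
Proof.
exists setT; first by split=> //; exact: openT.
apply: (@Ck_lin _ _ _ _ rsubmx k setT id); [exact: continuous_rsubmx|exact: openT|].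
exact: Ck_id.
Qed.

End CkAt.

(** * Smooth maps, pointwise *)

Section SmoothAt.
Context {R : realType}.

(** Charts that cover and have smooth transitions; [prod_good] transfers this
    to products, in particular to the double. *)
Definition good_atlas (M : topologicalType) n (a : atlas R M n) :=
  [/\ forall c, a c -> is_chart c,
      forall x, exists2 c, a c & chart_dom c x &
      forall c, a c -> smooth_on a (chart_dom c) c].

Definition smooth_at (M : topologicalType) n (a : atlas R M n)
    (W : normedModType R) (f : M -> W) x :=
  forall c, a c -> chart_dom c x -> forall k, Ck_at k (f \o chart_inv c) (c x).

Definition smooth_map_at (M N : topologicalType) m n (a : atlas R M m)
    (b : atlas R N n) (f : M -> N) x :=
  {for x, continuous f} /\
  forall c, b c -> chart_dom c (f x) -> smooth_at a (c \o f) x.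

Implicit Types (M N P : topologicalType) (W : normedModType R).

Lemma manifold_good M n (a : atlas R M n) : is_manifold a -> good_atlas a.
Proof. by case. Qed.

Lemma openI_preimage M N (U : set M) (f : M -> N) (B : set N) :
  open U -> open B -> (forall x, U x -> {for x, continuous f}) ->
  open (U `&` f @^-1` B).
Proof.
move=> oU oB cf; rewrite openE => x [Ux Bx]; apply: filterI.
  exact: open_nbhs_nbhs.
by apply: (cf x Ux); exact: open_nbhs_nbhs.
Qed.

Lemma chart_invK M n (c : chart R M n) x :
  is_chart c -> chart_dom c x -> chart_inv c (c x) = x.
Proof. by case=> _ _ h _ _ /h. Qed.

Lemma chart_dom_open M n (c : chart R M n) : is_chart c -> open (chart_dom c).
Proof. by case. Qed.

Lemma chart_inv_continuous M n (c : chart R M n) x :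
  is_chart c -> chart_dom c x -> {for c x, continuous (chart_inv c)}.
Proof. by case=> _ _ _ _ h dx; apply: h; exists x. Qed.

Lemma chart_open_img M n (c : chart R M n) (U : set M) :
  is_chart c -> open U -> open (c @` (chart_dom c `&` U)).
Proof.
move=> hc oU; have [_ oi ck _ ci] := hc.
have -> : c @` (chart_dom c `&` U) = chart_img c `&` chart_inv c @^-1` U.
  apply/seteqP; split=> [_ [x [dx Ux] <-]|_ [[x dx <-]]] /=.
    by rewrite ck//; split=> //; exists x.
  by rewrite ck// => Ux; exists x.
exact: openI_preimage.
Qed.

(** Continuity of [chart_inv c] at [c x], in the form needed to replace a
    function read in a chart by another one near [c x]. *)
Lemma chart_near M n (c : chart R M n) x (U : set M) :
  is_chart c -> chart_dom c x -> nbhs x U ->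
  \forall v \near c x, U (chart_inv c v) /\ chart_dom c (chart_inv c v).
Proof.
move=> hc dx xU; have cv := chart_inv_continuous hc dx.
have xUc : nbhs x (U `&` chart_dom c).
  by apply: filterI => //; apply: open_nbhs_nbhs; split=> //; exact: chart_dom_open hc.
by move: xUc; rewrite -[X in nbhs X](chart_invK hc dx) => /cv.
Qed.

Lemma smooth_onP M n (a : atlas R M n) W (U : set M) (f : M -> W) :
  (forall c, a c -> is_chart c) -> open U ->
  smooth_on a U f <-> forall x, U x -> smooth_at a f x.
Proof.
move=> ca oU; split=> [sf x Ux c ac dx k|sf c ac k].
  have oI := chart_open_img (ca c ac) oU.
  by apply: (Ck_at_on k (f \o chart_inv c) oI).1 (sf c ac k) _ _; exists x.
apply/Ck_at_on; first exact: chart_open_img (ca c ac) oU.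
by move=> _ [x [dx Ux] <-]; exact: sf.
Qed.

Lemma transition_Ck_at M n (a : atlas R M n) c c' x k :
  good_atlas a -> a c -> a c' -> chart_dom c x -> chart_dom c' x ->
  Ck_at k (c' \o chart_inv c) (c x).
Proof.
move=> [ca _ sa] ac ac' dx dx'.
have /smooth_onP := sa c' ac'; apply => //.
exact: chart_dom_open (ca _ ac').
Qed.

(** Near [c x], the function [f \o h] read in [c] is [f] read in [c'] composed
    with [h] read in [c] and [c']; the single chart [c'] at [h x] suffices. *)
Lemma smooth_at_comp1 M N m n (a : atlas R M m) (b : atlas R N n) W
    (h : M -> N) (f : N -> W) c' x :
  good_atlas a -> good_atlas b -> {for x, continuous h} ->
  b c' -> chart_dom c' (h x) -> smooth_at a (c' \o h) x ->
  smooth_at b f (h x) -> smooth_at a (f \o h) x.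
Proof.
move=> [ca _ _] [cb _ _] ch bc' dhx sh sf c ac dx k.
apply: (@Ck_at_ext _ _ _ _ ((f \o chart_inv c') \o (c' \o h \o chart_inv c))).
  have xc : nbhs x (h @^-1` chart_dom c').
    by apply: ch; apply: open_nbhs_nbhs; split=> //; exact: chart_dom_open (cb _ bc').
  have := chart_near (ca _ ac) dx xc; apply: filterS => v [/= dv _].
  by rewrite /= (chart_invK (cb _ bc') dv).
apply: Ck_at_comp; last exact: sh.
by rewrite /= (chart_invK (ca _ ac)) //; exact: sf.
Qed.

Lemma chart_smooth_at M n (a : atlas R M n) c x :
  good_atlas a -> a c -> chart_dom c x -> smooth_at a c x.
Proof. by move=> ga ac dx c' ac' dx' k; exact: (transition_Ck_at _ ga). Qed.

Lemma smooth_at_comp M N m n (a : atlas R M m) (b : atlas R N n) W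
    (h : M -> N) (f : N -> W) x :
  good_atlas a -> good_atlas b ->
  smooth_map_at a b h x -> smooth_at b f (h x) -> smooth_at a (f \o h) x.
Proof.
move=> ga gb [ch sh] sf; have [_ /(_ (h x)) [c bc dx] _] := gb.
exact: (smooth_at_comp1 ga gb ch bc dx (sh c bc dx)).
Qed.

Lemma smooth_map_at_comp M N P m n p (a : atlas R M m) (b : atlas R N n)
    (e : atlas R P p) (h : M -> N) (f : N -> P) x :
  good_atlas a -> good_atlas b ->
  smooth_map_at a b h x -> smooth_map_at b e f (h x) ->
  smooth_map_at a e (f \o h) x.
Proof.
move=> ga gb sh [cf sf]; split.
  by apply: continuous_comp; [case: sh|].
move=> c ec dx; have := sf c ec dx; exact: smooth_at_comp.
Qed.

Lemma smooth_map_at_id M m (a : atlas R M m) x :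
  good_atlas a -> smooth_map_at a a id x.
Proof. by move=> ga; split; [exact: cvg_id|move=> c ac dx; exact: chart_smooth_at]. Qed.

Lemma smooth_map_at_cst M N m n (a : atlas R M m) (b : atlas R N n) y x :
  smooth_map_at a b (fun=> y) x.
Proof.
split; first exact: cvg_cst.
by move=> c bc dy c' ac' dx k; exact: Ck_at_cst.
Qed.

(** Compositions and pairs are formed pointwise; this equivalence moves between
    that and smoothness on [U], the sets [U `&` f @^-1` chart_dom c] being open
    once [f] is known to be continuous. *)
Lemma smooth_map_onP M N m n (a : atlas R M m) (b : atlas R N n)
    (U : set M) (f : M -> N) :
  good_atlas a -> good_atlas b -> open U ->
  smooth_map_on a b U f <-> forall x, U x -> smooth_map_at a b f x.
Proof.
move=> [ca _ _] [cb _ _] oU; split=> [[cf sf] x Ux|sf].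
  split; first exact: cf.
  move=> c bc dx; have /smooth_onP : smooth_on a (U `&` f @^-1` chart_dom c) (c \o f).
    exact: sf.
  apply=> //; apply: openI_preimage => //; exact: chart_dom_open (cb _ bc).
have cf x : U x -> {for x, continuous f} by move=> /sf [].
split=> // c bc; apply/smooth_onP => //.
  by apply: openI_preimage => //; exact: chart_dom_open (cb _ bc).
by move=> x [/sf [_ +] dx]; apply.
Qed.

Lemma smooth_map_at_pair M N P m n p (a : atlas R M m) (b : atlas R N n)
    (e : atlas R P p) (f : M -> N) (h : M -> P) x :
  smooth_map_at a b f x -> smooth_map_at a e h x ->
  smooth_map_at a (prod_atlas b e) (fun y => (f y, h y)) x.
Proof.
move=> [cf sf] [ch sh]; split; first exact: cvg_pair.
move=> _ [c1 [c2 [bc1 ec2 ->]]] [/= d1 d2] c ac dx k.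
apply: (@Ck_at_row_mx _ _ _ _ k (c1 \o f \o chart_inv c) (c2 \o h \o chart_inv c)).
  exact: sf.
exact: sh.
Qed.

Lemma continuous_row_mx M m n (f : M -> 'rV[R]_m) (g : M -> 'rV[R]_n) x :
  {for x, continuous f} -> {for x, continuous g} ->
  {for x, continuous (fun y => row_mx (f y) (g y))}.
Proof.
move=> cf cg.
have C : Ck 0 setT (fun q : 'rV[R]_m * 'rV[R]_n => row_mx q.1 q.2).
  apply: Ck_row_mx; first exact: openT.
    by move=> p _; exact: cvg_fst.
  by move=> p _; exact: cvg_snd.
apply: (@continuous_comp _ _ _ (fun y => (f y, g y)) (fun q => row_mx q.1 q.2)).
  exact: (cvg_pair cf cg).
exact: C.
Qed.

Lemma prod_is_chart M N m n (c : chart R M m) (c' : chart R N n) :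
  is_chart c -> is_chart c' -> is_chart (prod_chart c c').
Proof.
move=> [ o1 i1 k1 c1 v1] [ o2 i2 k2 c2 v2]; split.
- have -> : chart_dom (prod_chart c c') =
      fst @^-1` chart_dom c `&` snd @^-1` chart_dom c'.
    by apply/seteqP; split=> [p []|p []].
  by apply: openI; apply: (continuousP _).1 => // p; [exact: cvg_fst|exact: cvg_snd].
- have -> : chart_img (prod_chart c c') =
      lsubmx @^-1` chart_img c `&` rsubmx @^-1` chart_img c'.
    apply/seteqP; split=> [_ [p [d1 d2] <-]|v [[x dx vx] [y dy vy]]].
      by rewrite /= row_mxKl row_mxKr; split; [exists p.1|exists p.2].
    by exists (x, y); [split|rewrite /= vx vy hsubmxK].
  apply: openI; apply: (continuousP _).1 => //.
    exact: continuous_lsubmx.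
  exact: continuous_rsubmx.
- by move=> [x y] [/= dx dy]; rewrite row_mxKl row_mxKr k1 ?k2.
- move=> [x y] [/= dx dy].
  apply: (continuous_row_mx (f := c \o fst) (g := c' \o snd)).
    by apply: (@continuous_comp _ _ _ fst c); [exact: cvg_fst|exact: c1].
  by apply: (@continuous_comp _ _ _ snd c'); [exact: cvg_snd|exact: c2].
- move=> _ [[x y] [/= dx dy] <-] /=.
  have h1 : {for row_mx (c x) (c' y), continuous (chart_inv c \o lsubmx)}.
    apply: continuous_comp; first exact: continuous_lsubmx.
    by rewrite row_mxKl; apply: v1; exists x.
  have h2 : {for row_mx (c x) (c' y), continuous (chart_inv c' \o rsubmx)}.
    apply: continuous_comp; first exact: continuous_rsubmx.
    by rewrite row_mxKr; apply: v2; exists y.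
  exact: (cvg_pair h1 h2).
Qed.

Lemma smooth_map_at_fst M N m n (a : atlas R M m) (b : atlas R N n) p :
  good_atlas a -> smooth_map_at (prod_atlas a b) a fst p.
Proof.
move=> ga; split; first exact: cvg_fst.
move=> c ac dx _ [c1 [c2 [ac1 bc2 ->]]] [d1 d2] k.
apply: (@Ck_at_comp _ _ _ _ k (c \o chart_inv c1) lsubmx).
  by rewrite /= row_mxKl; exact: (transition_Ck_at _ ga).
exact: Ck_at_lsubmx.
Qed.

Lemma smooth_map_at_snd M N m n (a : atlas R M m) (b : atlas R N n) p :
  good_atlas b -> smooth_map_at (prod_atlas a b) b snd p.
Proof.
move=> gb; split; first exact: cvg_snd.
move=> c bc dx _ [c1 [c2 [ac1 bc2 ->]]] [d1 d2] k.
apply: (@Ck_at_comp _ _ _ _ k (c \o chart_inv c2) rsubmx).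
  by rewrite /= row_mxKr; exact: (transition_Ck_at _ gb).
exact: Ck_at_rsubmx.
Qed.

Lemma prod_good M N m n (a : atlas R M m) (b : atlas R N n) :
  good_atlas a -> good_atlas b -> good_atlas (prod_atlas a b).
Proof.
move=> ga gb; have [ca va sa] := ga; have [cb vb sb] := gb.
have cp k : prod_atlas a b k -> is_chart k.
  by move=> [c [c' [ac bc' ->]]]; apply: prod_is_chart; auto.
split=> //.
  move=> [x y]; have [c ac dx] := va x; have [c' bc' dy] := vb y.
  by exists (prod_chart c c') => //; exists c, c'.
move=> _ [c1 [c2 [ac1 bc2 ->]]]; apply/smooth_onP => //.
  by apply: chart_dom_open; apply: prod_is_chart; auto.
move=> x [d1 d2] k abk dk n0.
apply: (@Ck_at_row_mx _ _ _ _ n0 (c1 \o fst \o chart_inv k) (c2 \o snd \o chart_inv k)).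
  by apply: (smooth_map_at_fst b x ga).2.
by apply: (smooth_map_at_snd a x gb).2.
Qed.

End SmoothAt.

(** * Curves and their velocities *)

Section Curves.
Context {R : realType}.
Implicit Types (M N : topologicalType) (W : normedModType R).

Definition curve_at M n (a : atlas R M n) (p : R -> M) :=
  {for 0, continuous p} /\
  forall c, a c -> chart_dom c (p 0) -> derivable (c \o p) 0 1.

Lemma is_derive_derive1 W (f : R -> W) (v : W) :
  is_derive (0 : R) 1 f v -> derive1 f 0 = v.
Proof. by move=> [_ <-]; rewrite derive1E. Qed.

Lemma derivable_is_derive1 W (f : R -> W) :
  derivable f 0 1 -> is_derive (0 : R) 1 f (derive1 f 0).
Proof. by move=> df; rewrite derive1E; exact: DeriveDef. Qed.

(** Chain rule along a curve, read in a chart. *)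
Lemma is_derive_chart M n (a : atlas R M n) W (f : M -> W) c (p : R -> M) v :
  good_atlas a -> a c -> chart_dom c (p 0) -> {for 0, continuous p} ->
  is_derive (0 : R) 1 (c \o p) v -> smooth_at a f (p 0) ->
  is_derive (0 : R) 1 (f \o p) ('d (f \o chart_inv c) (c (p 0)) v).
Proof.
move=> [ca _ _] ac dx cp [dcp <-] sf.
have df : differentiable (f \o chart_inv c) (c (p 0)).
  exact: Ck_at_differentiable (sf c ac dx 1).
have dp : differentiable (c \o p) (0 : R) by apply/derivable1_diffP.
apply: (@near_eq_is_derive _ _ _ ((f \o chart_inv c) \o (c \o p))).
  have : \forall t \near (0 : R), chart_dom c (p t).
    apply: cp; apply: open_nbhs_nbhs; split=> //.
    exact: chart_dom_open (ca _ ac).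
  by apply: filterS => t dt; rewrite /= (chart_invK (ca _ ac) dt).
have dfp : differentiable ((f \o chart_inv c) \o (c \o p)) (0 : R).
  exact: differentiable_comp.
apply: DeriveDef; first exact: diff_derivable.
by rewrite !deriveE// diff_comp.
Qed.

Lemma is_derive_curve M n (a : atlas R M n) W (f : M -> W) (p : R -> M) :
  good_atlas a -> curve_at a p -> smooth_at a f (p 0) ->
  derivable (f \o p) 0 1.
Proof.
move=> ga [cp dp] sf; have [_ /(_ (p 0)) [c ac dx] _] := ga.
have [//] := is_derive_chart ga ac dx cp (derivable_is_derive1 (dp _ ac dx)) sf.
Qed.

Lemma same_velocity_fun M n (a : atlas R M n) W (f : M -> W) (p q : R -> M) :
  good_atlas a -> same_velocity a p q -> smooth_at a f (p 0) ->
  [/\ derivable (f \o p) 0 1, derivable (f \o q) 0 1 &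
      derive1 (f \o p) 0 = derive1 (f \o q) 0].
Proof.
move=> ga [pq cp cq dpq] sf; have [_ /(_ (p 0)) [c ac dx] _] := ga.
have [dp dq epq] := dpq c ac dx.
have ip := is_derive_chart ga ac dx cp (derivable_is_derive1 dp) sf.
move: dx sf; rewrite pq => dx sf.
have iq := is_derive_chart ga ac dx cq (derivable_is_derive1 dq) sf.
split; [by case: ip|by case: iq|].
by rewrite (is_derive_derive1 ip) (is_derive_derive1 iq) epq pq.
Qed.

Lemma same_velocity_curve M n (a : atlas R M n) (p q : R -> M) :
  same_velocity a p q -> curve_at a p /\ curve_at a q.
Proof.
move=> [pq cp cq dpq]; split; (split; first by [exact: cp|exact: cq]) => c ac.
  by move=> /(dpq c ac) [h _ _]; exact: h.
by rewrite -pq => /(dpq c ac) [_ h _]; exact: h.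
Qed.

Lemma same_velocity_refl M n (a : atlas R M n) (p : R -> M) :
  curve_at a p -> same_velocity a p p.
Proof.
move=> [cp dp]; split; [by []|exact: cp|exact: cp|move=> c ac dx].
by split; [exact: dp|exact: dp|].
Qed.

Lemma same_velocity_trans M n (a : atlas R M n) (p q o : R -> M) :
  same_velocity a p q -> same_velocity a q o -> same_velocity a p o.
Proof.
move=> [pq cp cq dpq] [qo _ co dqo].
split; [by rewrite pq|exact: cp|exact: co|move=> c ac dx].
have [dp _ ->] := dpq c ac dx; move: dx; rewrite pq => /(dqo c ac) [_ dq e].
by split; [exact: dp|exact: dq|].
Qed.

Lemma same_velocity_near M n (a : atlas R M n) (p p' q : R -> M) :
  (\forall t \near (0 : R), p t = p' t) ->
  same_velocity a p q -> same_velocity a p' q.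
Proof.
move=> pp [pq cp cq dpq]; have e0 : p 0 = p' 0 := nbhs_singleton pp.
have cp' : {for 0, continuous p'}.
  rewrite /prop_for /continuous_at -e0.
  exact: (cvg_trans (near_eq_cvg pp) cp).
split; [by rewrite -e0|exact: cp'|exact: cq|move=> c ac dx].
rewrite -e0 in dx; have [dp dq epq] := dpq c ac dx.
have cpp : \forall t \near (0 : R), (c \o p) t = (c \o p') t.
  by apply: filterS pp => t /= ->.
split; [exact: near_eq_derivable cpp dp|exact: dq|].
by rewrite -epq !derive1E; exact/esym/near_eq_derive.
Qed.

Lemma curve_at1 M n (a : atlas R M n) c (p : R -> M) :
  good_atlas a -> a c -> chart_dom c (p 0) -> {for 0, continuous p} ->
  derivable (c \o p) 0 1 -> curve_at a p.
Proof.
move=> ga ac dx cp dp; split; first exact: cp.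
move=> c' ac' dx'.
have [+ _] := is_derive_chart ga ac dx cp (derivable_is_derive1 dp)
  (chart_smooth_at ga ac' dx').
exact.
Qed.

(** In any other chart, both derivatives are the images of those in [c] under
    the same differential, that of the transition map. *)
Lemma same_velocity1 M n (a : atlas R M n) c (p q : R -> M) :
  good_atlas a -> a c -> chart_dom c (p 0) -> p 0 = q 0 ->
  curve_at a p -> curve_at a q ->
  derive1 (c \o p) 0 = derive1 (c \o q) 0 -> same_velocity a p q.
Proof.
move=> ga ac dx pq [cp dp] [cq dq] epq.
split; [by []|exact: cp|exact: cq|move=> c' ac' dx'].
have ip := is_derive_chart ga ac dx cp (derivable_is_derive1 (dp c ac dx))
  (chart_smooth_at ga ac' dx').
move: (dx) (dx'); rewrite pq => dy dy'.
have iq := is_derive_chart ga ac dy cq (derivable_is_derive1 (dq c ac dy))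
  (chart_smooth_at ga ac' dy').
split; [exact: dp|exact: dq|].
by rewrite (is_derive_derive1 ip) (is_derive_derive1 iq) epq pq.
Qed.

Lemma curve_at_comp M N m n (a : atlas R M m) (b : atlas R N n) (f : M -> N)
    (p : R -> M) :
  good_atlas a -> curve_at a p -> smooth_map_at a b f (p 0) ->
  curve_at b (f \o p).
Proof.
move=> ga cp [cf sf]; have [cp0 _] := cp; split.
  exact: continuous_comp.
by move=> c bc dx; apply: (is_derive_curve ga cp (f := c \o f)); exact: sf.
Qed.

(** The differential of [f], without tangent spaces: [f] sends curves with the
    same velocity to curves with the same velocity. *)
Lemma same_velocity_comp M N m n (a : atlas R M m) (b : atlas R N n)
    (f : M -> N) (p q : R -> M) :
  good_atlas a -> same_velocity a p q -> smooth_map_at a b f (p 0) ->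
  same_velocity b (f \o p) (f \o q).
Proof.
move=> ga vpq sf; have [hp hq] := same_velocity_curve vpq.
have [pq _ _ _] := vpq; have [cfp _] := curve_at_comp ga hp sf.
have : smooth_map_at a b f (q 0) by rewrite -pq.
move=> /(curve_at_comp ga hq) [cfq _].
split; [by rewrite /= pq|exact: cfp|exact: cfq|move=> c bc dx].
apply: (same_velocity_fun (f := c \o f) ga vpq).
by case: sf => _; exact.
Qed.

Lemma is_derive_row_mx m n (f : R -> 'rV[R]_m) (g : R -> 'rV[R]_n) u v :
  is_derive (0 : R) 1 f u -> is_derive (0 : R) 1 g v ->
  is_derive (0 : R) 1 (fun t => row_mx (f t) (g t)) (row_mx u v).
Proof.
move=> [df <-] [dg <-].
have dfi j := (derivable_mxP f 0 1).1 df 0 j.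
have dgi j := (derivable_mxP g 0 1).1 dg 0 j.
have el i : (fun t => row_mx (f t) (g t) 0 (lshift n i)) = (fun t => f t 0 i).
  by apply/funext => t; rewrite row_mxEl.
have er i : (fun t => row_mx (f t) (g t) 0 (rshift m i)) = (fun t => g t 0 i).
  by apply/funext => t; rewrite row_mxEr.
have dfg : derivable (fun t => row_mx (f t) (g t)) 0 1.
  apply/derivable_mxP => i j; rewrite ord1.
  by case: (split_ordP j) => k ->; rewrite ?el ?er.
apply: DeriveDef => //; rewrite derive_mx//; apply/rowP => j; rewrite !mxE.
case: (split_ordP j) => k ->; rewrite ?el ?er ?row_mxEl ?row_mxEr derive_mx// mxE//.
Qed.

Lemma curve_at_pair M N m n (a : atlas R M m) (b : atlas R N n) p q :
  curve_at a p -> curve_at b q ->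
  curve_at (prod_atlas a b) (fun t => (p t, q t)).
Proof.
move=> [cp dp] [cq dq]; split; first exact: cvg_pair.
move=> _ [c [c' [ac bc' ->]]] [/= d1 d2].
by have [] := is_derive_row_mx (derivable_is_derive1 (dp c ac d1))
  (derivable_is_derive1 (dq c' bc' d2)).
Qed.

Lemma curve_at_cst M n (a : atlas R M n) x : curve_at a (fun=> x).
Proof.
split; first exact: cvg_cst.
by move=> c ac dx; exact: derivable_cst.
Qed.

(** The differential at a point of a product is additive, and the velocity of
    [(p, q)] is the sum of the velocities with one component frozen. All
    product rules on groups come from here. *)
Lemma derive1_pair M N m n (a : atlas R M m) (b : atlas R N n) W
    (f : M * N -> W) (p : R -> M) (q : R -> N) :
  good_atlas a -> good_atlas b -> curve_at a p -> curve_at b q ->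
  smooth_at (prod_atlas a b) f (p 0, q 0) ->
  derive1 (fun t => f (p t, q t)) 0
  = derive1 (fun t => f (p t, q 0)) 0 + derive1 (fun t => f (p 0, q t)) 0.
Proof.
move=> ga gb hp hq sf; have gab := prod_good ga gb.
have [cp dp] := hp; have [cq dq] := hq.
have [_ /(_ (p 0)) [c ac dx] _] := ga; have [_ /(_ (q 0)) [c' bc' dy] _] := gb.
have abk : prod_atlas a b (prod_chart c c') by exists c, c'.
have vp := derivable_is_derive1 (dp c ac dx).
have vq := derivable_is_derive1 (dq c' bc' dy).
have zp : is_derive (0 : R) 1 (fun=> c (p 0)) 0 by exact: is_derive_cst.
have zq : is_derive (0 : R) 1 (fun=> c' (q 0)) 0 by exact: is_derive_cst.
have K := is_derive_chart (c := prod_chart c c') (f := f) gab abk.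
have k1 := K (fun t => (p t, q t)) _ (conj dx dy)
  (curve_at_pair hp hq).1 (is_derive_row_mx vp vq) sf.
have k2 := K (fun t => (p t, q 0)) _ (conj dx dy)
  (curve_at_pair hp (curve_at_cst b (q 0))).1 (is_derive_row_mx vp zq) sf.
have k3 := K (fun t => (p 0, q t)) _ (conj dx dy)
  (curve_at_pair (curve_at_cst a (p 0)) hq).1 (is_derive_row_mx zp vq) sf.
rewrite (is_derive_derive1 k1) (is_derive_derive1 k2) (is_derive_derive1 k3).
by rewrite -linearD add_row_mx addr0 add0r.
Qed.

End Curves.

(** * First-order calculus on a Lie group *)

Section SmoothGroups.
Context {R : realType}.

(** A Lie group and its exponential map, in a form which is stable under
    products, so that it covers [G], its dual group and the double alike. *)
Definition smooth_group (A : topGroupType) n (a : atlas R A n) :=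
  [/\ good_atlas a,
      forall p, smooth_map_at (prod_atlas a a) a
                  (fun p : A * A => (p.1 * p.2)%g) p &
      forall x, smooth_map_at a a (fun x : A => x^-1%g) x].

Definition exp_map (A : topGroupType) n (a : atlas R A n) (v : vectType R)
    (e : v -> A) :=
  [/\ forall (s t : R) X, e ((s + t) *: X) = (e (s *: X) * e (t *: X))%g,
      forall X, {for 0, continuous (fun t : R => e (t *: X))} &
      forall c, a c -> chart_dom c 1%g ->
        exists L : v -> 'rV[R]_n, [/\ linear L, bijective L &
          forall X, is_derive (0 : R) 1 (fun t : R => c (e (t *: X))) (L X)]].

Lemma lie_smooth_group (G : lieGroup R) : smooth_group (lie_atlas G).
Proof.
have ga := manifold_good (lie_manifold G).
split=> // [p|x].
  have /smooth_map_onP := @lie_mul R G.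
  by apply=> //; [exact: prod_good|exact: openT].
have /smooth_map_onP := @lie_inv R G.
by apply=> //; exact: openT.
Qed.

Lemma lie_exp_map (G : lieGroup R) (g : vectType R) br (e : g -> G) :
  is_lie_exp br e -> exp_map (lie_atlas G) e.
Proof. by case=> h1 h2 h3 _; split. Qed.

(** [p] passes through 1 at time 0 with velocity [X]. *)
Definition has_vel (A : topGroupType) n (a : atlas R A n) (v : vectType R)
  (e : v -> A) (p : R -> A) (X : v) :=
  same_velocity a p (fun t : R => e (t *: X)).

Section OneGroup.
Context (A : topGroupType) n (a : atlas R A n) (v : vectType R) (e : v -> A).
Hypotheses (sg : smooth_group a) (em : exp_map a e).
Local Notation has_vel := (has_vel a e).
Implicit Types (p q : R -> A) (X Y : v) (x y : A) (W : normedModType R).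

Let ga : good_atlas a. Proof. by case: sg. Qed.

Lemma exp0 : e 0 = 1%g.
Proof.
have [h _ _] := em; have := h 0 0 0; rewrite !scaler0 => h0.
by apply: (mulgI (e 0)); rewrite mulg1 -h0.
Qed.

Lemma smooth_mul M m (b : atlas R M m) (f h : M -> A) z :
  good_atlas b -> smooth_map_at b a f z -> smooth_map_at b a h z ->
  smooth_map_at b a (fun z => (f z * h z)%g) z.
Proof.
move=> gb sf sh; have [_ sm _] := sg.
apply: (smooth_map_at_comp gb (prod_good ga ga) (h := fun z => (f z, h z))
  (f := fun p : A * A => (p.1 * p.2)%g)); last exact: sm.
exact: smooth_map_at_pair.
Qed.

Lemma smooth_inv M m (b : atlas R M m) (f : M -> A) z :
  good_atlas b -> smooth_map_at b a f z ->
  smooth_map_at b a (fun z => (f z)^-1%g) z.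
Proof.
move=> gb sf; have [_ _ si] := sg.
by apply: (smooth_map_at_comp gb ga (h := f) (f := fun x : A => x^-1%g)).
Qed.

Lemma smooth_trans x y z : smooth_map_at a a (fun z => (x * z * y)%g) z.
Proof.
apply: smooth_mul => //; last exact: smooth_map_at_cst.
by apply: smooth_mul => //; [exact: smooth_map_at_cst|exact: smooth_map_at_id].
Qed.

Lemma exp_curve X : curve_at a (fun t => e (t *: X)).
Proof.
have [_ ce te] := em; have [_ /(_ 1%g) [c ac dc] _] := ga.
have [L [_ _ dL]] := te c ac dc.
apply: (curve_at1 ga ac) => /=; [by rewrite scale0r exp0|exact: ce|].
by have [h _] := dL X; exact: h.
Qed.

Lemma has_vel_exp X : has_vel (fun t => e (t *: X)) X.
Proof. exact/same_velocity_refl/exp_curve. Qed.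

Lemma has_vel1 p X : has_vel p X -> p 0 = 1%g.
Proof. by case=> -> _ _ _; rewrite scale0r exp0. Qed.

Lemma has_vel_curve p X : has_vel p X -> curve_at a p.
Proof. by move/same_velocity_curve => [h _]; exact: h. Qed.

Lemma has_vel_unique p X Y : has_vel p X -> has_vel p Y -> X = Y.
Proof.
move=> pX pY; have [_ _ te] := em; have [_ /(_ 1%g) [c ac dc] _] := ga.
have [L [_ /bij_inj iL dL]] := te c ac dc; apply: iL.
have p1 := has_vel1 pX; rewrite -p1 in dc.
have [_ _ _ /(_ c ac dc) [_ _]] := pX; have [_ _ _ /(_ c ac dc) [_ _]] := pY.
by rewrite (is_derive_derive1 (dL X)) (is_derive_derive1 (dL Y)) => <- ->.
Qed.

Lemma has_vel_exists p : curve_at a p -> p 0 = 1%g -> exists X, has_vel p X.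
Proof.
move=> cp p1; have [_ _ te] := em; have [_ /(_ 1%g) [c ac dc] _] := ga.
have [L [_ [L' LK L'K] dL]] := te c ac dc.
exists (L' (derive1 (c \o p) 0)).
apply: (same_velocity1 ga ac); [by rewrite p1|by rewrite p1 scale0r exp0|exact: cp| |].
  exact: exp_curve.
by rewrite (is_derive_derive1 (dL _)) L'K.
Qed.

(** Read in a chart [c] at 1, the product has the derivative of [c \o p] plus
    that of [c \o q] by [derive1_pair], and the chart isomorphism is linear. *)
Lemma has_velM p q X Y :
  has_vel p X -> has_vel q Y -> has_vel (fun t => (p t * q t)%g) (X + Y).
Proof.
move=> pX qY; have [_ _ te] := em; have [_ /(_ 1%g) [c ac dc] _] := ga.
have [L [lL _ dL]] := te c ac dc.
have p1 := has_vel1 pX; have q1 := has_vel1 qY.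
have cp := has_vel_curve pX; have cq := has_vel_curve qY.
have [_ sm _] := sg.
apply: (same_velocity1 ga ac).
- by rewrite p1 q1 mulg1.
- by rewrite p1 q1 mulg1 scale0r exp0.
- apply: (curve_at_comp (prod_good ga ga) (f := fun p : A * A => (p.1 * p.2)%g)
    (curve_at_pair cp cq)); exact: sm.
- exact: exp_curve.
rewrite (is_derive_derive1 (dL _)).
have sc : smooth_at (prod_atlas a a) (c \o (fun p : A * A => (p.1 * p.2)%g)) (p 0, q 0).
  apply: (smooth_at_comp (prod_good ga ga) ga); first exact: sm.
  by apply: chart_smooth_at => //=; rewrite p1 q1 mulg1.
rewrite [LHS](derive1_pair ga ga cp cq sc) /= p1 q1.
have -> : (fun t => c (p t * 1)%g) = c \o p by apply/funext => t; rewrite mulg1.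
have -> : (fun t => c (1 * q t)%g) = c \o q by apply/funext => t; rewrite mul1g.
have dp := dc; have dq := dc; rewrite -p1 in dp; rewrite -q1 in dq.
have [_ _ _ /(_ c ac dp) [_ _ ->]] := pX; have [_ _ _ /(_ c ac dq) [_ _ ->]] := qY.
rewrite (is_derive_derive1 (dL X)) (is_derive_derive1 (dL Y)).
by have := lL 1 X Y; rewrite !scale1r => ->.
Qed.

Lemma has_vel_cst : has_vel (fun=> 1%g) 0.
Proof.
have -> : (fun=> 1%g) = (fun t : R => e (t *: 0)).
  by apply/funext => t; rewrite scaler0 exp0.
exact: has_vel_exp.
Qed.

Lemma curve_trans x y p : curve_at a p -> curve_at a (fun t => (x * p t * y)%g).
Proof.
move=> cp; apply: (curve_at_comp ga (f := fun z => (x * z * y)%g) cp).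
exact: smooth_trans.
Qed.

(** The product with the inverse is constant, so the velocities add to 0. *)
Lemma has_velV p X : has_vel p X -> has_vel (fun t => (p t)^-1%g) (- X).
Proof.
move=> pX; have p1 := has_vel1 pX; have [_ _ si] := sg.
have cV : curve_at a (fun t => (p t)^-1%g).
  exact: (curve_at_comp ga (has_vel_curve pX) (si (p 0))).
have [|Y pY] := has_vel_exists cV; first by rewrite p1 invg1.
suff -> : - X = Y by [].
have := has_velM pX pY.
have -> : (fun t => p t * (p t)^-1)%g = (fun=> 1%g).
  by apply/funext => t; rewrite mulgV.
move=> /(has_vel_unique has_vel_cst) /esym /eqP.
by rewrite addrC addr_eq0 => /eqP ->.
Qed.

(** The adjoint action, read off the conjugate of a one-parameter subgroup; by
    [has_vel_Ad] any curve with the same velocity gives the same result. *)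
Definition Ad x X : v := xget 0 [set Y | has_vel (fun t => x * e (t *: X) * x^-1)%g Y].

Lemma has_vel_Ad x p X : has_vel p X -> has_vel (fun t => x * p t * x^-1)%g (Ad x X).
Proof.
move=> pX.
have AdP : has_vel (fun t => x * e (t *: X) * x^-1)%g (Ad x X).
  have [|Y hY] := has_vel_exists (curve_trans x x^-1%g (exp_curve X)).
    by rewrite scale0r exp0 mulg1 mulgV.
  exact: (xgetPex 0 (ex_intro _ Y hY)).
apply: same_velocity_trans AdP.
exact: (same_velocity_comp ga pX (smooth_trans x x^-1%g (p 0))).
Qed.

Lemma AdM x y X : Ad (x * y)%g X = Ad x (Ad y X).
Proof.
have := has_vel_Ad (x * y)%g (has_vel_exp X).
have := has_vel_Ad x (has_vel_Ad y (has_vel_exp X)).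
have -> : (fun t => x * (y * e (t *: X) * y^-1) * x^-1)%g =
   (fun t => (x * y) * e (t *: X) * (x * y)^-1)%g.
  by apply/funext => t; rewrite invgM !mulgA.
by move=> h1 h2; exact: has_vel_unique h2 h1.
Qed.

Lemma Ad1 X : Ad 1%g X = X.
Proof.
have := has_vel_Ad 1%g (has_vel_exp X).
have -> : (fun t => 1 * e (t *: X) * 1^-1)%g = (fun t => e (t *: X)).
  by apply/funext => t; rewrite invg1 mulg1 mul1g.
by move=> h1; exact: has_vel_unique h1 (has_vel_exp X).
Qed.

Lemma AdK x X : Ad x^-1%g (Ad x X) = X.
Proof. by rewrite -AdM mulVg Ad1. Qed.

Lemma AdKV x X : Ad x (Ad x^-1%g X) = X.
Proof. by rewrite -AdM mulgV Ad1. Qed.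

(** Source of the gradients: in a chart at 1 this functional is a differential
    composed with the linear isomorphism of [exp_map]. *)
Lemma derive1_exp_linear W (f : A -> W) :
  smooth_at a f 1%g -> linear (fun X => derive1 (fun t : R => f (e (t *: X))) 0).
Proof.
move=> sf; have [_ ce te] := em; have [_ /(_ 1%g) [c ac dc] _] := ga.
have [L [lL _ dL]] := te c ac dc.
have h X : derive1 (fun t : R => f (e (t *: X))) 0 = 'd (f \o chart_inv c) (c 1%g) (L X).
  have e1 : e (0 *: X) = 1%g by rewrite scale0r exp0.
  have K := is_derive_chart (p := fun t => e (t *: X)) (f := f) (v := L X) ga ac.
  have := K _ (ce X) (dL X); rewrite e1 => /(_ dc sf).
  exact: is_derive_derive1.
by move=> k X Y; rewrite !h lL linearP.
Qed.

Lemma smooth_translr W (f : A -> W) y x : smooth_at a f (x * y)%g ->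
  smooth_at a (fun z => f (z * y)%g) x.
Proof.
move=> sf; apply: (smooth_at_comp ga ga (h := fun z => (z * y)%g) _ sf).
by apply: smooth_mul => //; [exact: smooth_map_at_id|exact: smooth_map_at_cst].
Qed.

Lemma smooth_transll W (f : A -> W) y x : smooth_at a f (y * x)%g ->
  smooth_at a (fun z => f (y * z)%g) x.
Proof.
move=> sf; apply: (smooth_at_comp ga ga (h := fun z => (y * z)%g) _ sf).
by apply: smooth_mul => //; [exact: smooth_map_at_cst|exact: smooth_map_at_id].
Qed.

Lemma has_vel_derive1 W (f : A -> W) p X : smooth_at a f 1%g -> has_vel p X ->
  derive1 (fun t => f (p t)) 0 = derive1 (fun t => f (e (t *: X))) 0.
Proof.
move=> sf pX; have p1 := has_vel1 pX; rewrite -p1 in sf.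
by have [_ _ h] := same_velocity_fun ga pX sf; exact: h.
Qed.

End OneGroup.

Lemma has_vel_hom (A B : topGroupType) m n (a : atlas R A m) (b : atlas R B n)
    (v w : vectType R) (eA : v -> A) (eB : w -> B) (f : A -> B) (l : v -> w) p X :
  smooth_group a -> exp_map a eA -> smooth_map_at a b f 1%g ->
  (forall X, f (eA X) = eB (l X)) -> (forall k X, l (k *: X) = k *: l X) ->
  has_vel a eA p X -> has_vel b eB (f \o p) (l X).
Proof.
move=> sg em sf fe lZ pX; have p1 := has_vel1 em pX; have [ga _ _] := sg.
rewrite /has_vel.
have -> : (fun t : R => eB (t *: l X)) = f \o (fun t => eA (t *: X)).
  by apply/funext => t; rewrite /= fe lZ.
by apply: same_velocity_comp ga pX _; rewrite p1.
Qed.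

End SmoothGroups.

(** * Linear algebra of the double *)

Section DoubleAlgebra.
Context {R : realType} (g : factLieBialgebra R).
Local Notation r := (flb_r g).
Local Notation sp := (@flb_sp R g).
Local Notation br := (@flb_br R g).
Local Notation d := (g * g)%type.
Implicit Types (X Y Z W : g) (xi eta u v : d) (k e : R).

Lemma spDr X Y Z : sp X (Y + Z) = sp X Y + sp X Z.
Proof. by have := sp_linear X 1 Y Z; rewrite scale1r mul1r. Qed.
Lemma sp0r X : sp X 0 = 0.
Proof. by have := spDr X 0 0; rewrite addr0 -{1}[sp X 0]addr0 => /addrI. Qed.
Lemma spZr X k Y : sp X (k *: Y) = k * sp X Y.
Proof. by have := sp_linear X k Y 0; rewrite addr0 sp0r addr0. Qed.
Lemma spNr X Y : sp X (- Y) = - sp X Y.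
Proof. by rewrite -scaleN1r spZr mulN1r. Qed.
Lemma spDl X Y Z : sp (X + Y) Z = sp X Z + sp Y Z.
Proof. by rewrite !(sp_sym _ Z) spDr. Qed.
Lemma spZl k X Y : sp (k *: X) Y = k * sp X Y.
Proof. by rewrite !(sp_sym _ Y) spZr. Qed.
Lemma spNl X Y : sp (- X) Y = - sp X Y.
Proof. by rewrite !(sp_sym _ Y) spNr. Qed.
(** Equalities in [g] are proved below by pairing with an arbitrary vector,
    expanding with [spE], and calling [ring] or [field] in [R]. *)
Definition spE := (spDl, spDr, spZl, spZr, spNl, spNr).

Lemma sp_ext X Y : (forall Z, sp X Z = sp Y Z) -> X = Y.
Proof.
move=> h; apply/eqP; rewrite -subr_eq0; apply/eqP; apply: sp_nondeg => Z.
by rewrite !spE h subrr.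
Qed.

Lemma brDr X Y Z : br X (Y + Z) = br X Y + br X Z.
Proof. by have := br_linearr X 1 Y Z; rewrite !scale1r. Qed.
Lemma br0r X : br X 0 = 0.
Proof. by have := brDr X 0 0; rewrite addr0 -{1}[br X 0]addr0 => /addrI. Qed.
Lemma brZr X k Y : br X (k *: Y) = k *: br X Y.
Proof. by have := br_linearr X k Y 0; rewrite addr0 br0r addr0. Qed.
Lemma brNr X Y : br X (- Y) = - br X Y.
Proof. by rewrite -scaleN1r brZr scaleN1r. Qed.
Lemma brC X Y : br X Y = - br Y X.
Proof.
apply/eqP; rewrite -addr_eq0; apply/eqP; have := br_alt (X + Y).
have brDl U V : br (U + V) (X + Y) = br U (X + Y) + br V (X + Y).
  by have := br_linearl (X + Y) 1 U V; rewrite !scale1r.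
by rewrite brDl !brDr !br_alt add0r addr0.
Qed.
Lemma brDl X Y Z : br (X + Y) Z = br X Z + br Y Z.
Proof. by rewrite !(brC _ Z) brDr opprD. Qed.
Lemma brZl k X Y : br (k *: X) Y = k *: br X Y.
Proof. by rewrite !(brC _ Y) brZr scalerN. Qed.
Lemma brNl X Y : br (- X) Y = - br X Y.
Proof. by rewrite !(brC _ Y) brNr. Qed.
Definition brE := (brDl, brDr, brZl, brZr, brNl, brNr).

Lemma r_plusE X : r_plus g X = 2^-1 *: (r X + X).
Proof. by rewrite /r_plus !lfunE /= !lfunE /= lfunE. Qed.
Lemma r_minusE X : r_minus g X = 2^-1 *: (r X - X).
Proof. by rewrite /r_minus !lfunE /= !lfunE /= !lfunE /= lfunE. Qed.

Lemma spdDr xi u v : spd xi (u + v) = spd xi u + spd xi v.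
Proof. rewrite /spd /= !spE; ring. Qed.
Lemma spdZr xi k u : spd xi (k *: u) = k * spd xi u.
Proof. rewrite /spd /= !spE; ring. Qed.
Lemma spdNr xi u : spd xi (- u) = - spd xi u.
Proof. rewrite /spd /= !spE; ring. Qed.
Lemma spdC xi eta : spd xi eta = spd eta xi.
Proof. by rewrite /spd !(sp_sym xi.1, sp_sym xi.2). Qed.
Lemma spdDl u v xi : spd (u + v) xi = spd u xi + spd v xi.
Proof. by rewrite !(spdC _ xi) spdDr. Qed.
Lemma spdZl k u xi : spd (k *: u) xi = k * spd u xi.
Proof. by rewrite !(spdC _ xi) spdZr. Qed.
Lemma spdNl u xi : spd (- u) xi = - spd u xi.
Proof. by rewrite !(spdC _ xi) spdNr. Qed.
Definition spdE := (spdDl, spdDr, spdZl, spdZr, spdNl, spdNr).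

Lemma spd_nondeg u : (forall xi, spd u xi = 0) -> u = 0.
Proof.
case: u => u1 u2 h; congr (_, _); apply: sp_nondeg => Y.
  by have := h (Y, 0); rewrite /spd /= sp0r subr0.
by have := h (0, - Y); rewrite /spd /= sp0r spNr opprK add0r.
Qed.

Lemma spd_ext u v : (forall xi, spd u xi = spd v xi) -> u = v.
Proof.
move=> h; apply/eqP; rewrite -subr_eq0; apply/eqP; apply: spd_nondeg => xi.
by rewrite !spdE h subrr.
Qed.

(** The double is the direct sum of the diagonal and of the image of [emb_gs];
    [rd] is the difference of the two projections, with eigenvalue -1 on the
    former and 1 on the latter. *)
Lemma rd_emb_g X : rd (emb_g X) = - emb_g X.
Proof.
by congr (_, _); rewrite /= ?r_plusE ?r_minusE; apply: sp_ext => Z;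
  rewrite !spE; field.
Qed.

Lemma rd_emb_gs X : rd (emb_gs X) = emb_gs X.
Proof.
by congr (_, _); rewrite /= ?r_plusE ?r_minusE !(linearD, linearZ, linearN) /=;
  apply: sp_ext => Z; rewrite !spE; field.
Qed.

Lemma rdD u v : rd (u + v) = rd u + rd v.
Proof.
by congr (_, _); rewrite /= !(linearD, linearZ, linearN) /=; apply: sp_ext => Z;
  rewrite !spE; ring.
Qed.
Lemma rdZ k u : rd (k *: u) = k *: rd u.
Proof.
by congr (_, _); rewrite /= !(linearD, linearZ, linearN) /=; apply: sp_ext => Z;
  rewrite !spE; ring.
Qed.

Lemma rdN u : rd (- u) = - rd u.
Proof. by rewrite -scaleN1r rdZ scaleN1r. Qed.

Lemma rd_skew xi eta : spd (rd xi) eta = - spd xi (rd eta).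
Proof.
rewrite /spd /rd /= !r_plusE !r_minusE !spE.
rewrite (r_skew xi.1 eta.1) (r_skew xi.2 eta.1) (r_skew xi.1 eta.2) (r_skew xi.2 eta.2).
by field.
Qed.

Lemma emb_g_iso X Y : spd (emb_g X) (emb_g Y) = 0.
Proof. by rewrite /spd subrr. Qed.

Lemma emb_gs_iso X Y : spd (emb_gs X) (emb_gs Y) = 0.
Proof.
rewrite /spd /= !r_plusE !r_minusE !spE.
by rewrite (r_skew X Y); field.
Qed.

Lemma emb_gsZ k X : emb_gs (k *: X) = k *: emb_gs X.
Proof. by rewrite /emb_gs !linearZ. Qed.

Lemma spd_emb_gs_g X Y : spd (emb_gs X) (emb_g Y) = sp X Y.
Proof. by rewrite /spd /= r_plusE r_minusE !spE; field. Qed.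

Lemma spd_emb_g_gs X Y : spd (emb_g X) (emb_gs Y) = sp X Y.
Proof. by rewrite spdC spd_emb_gs_g sp_sym. Qed.

(** The linearization at 1 of the Poisson bracket of the double, a bracket on
    its dual, carried to the double by [spd]. *)
Definition drd u v : d := 2^-1 *: (brd (rd u) v + brd u (rd v)).

Lemma rd1E u : (rd u).1 = r (u.1 - u.2) - u.2.
Proof.
rewrite /= r_plusE !(linearD, linearN) /=; apply: sp_ext => Y.
by rewrite !spE; field.
Qed.

Lemma rd2E u : (rd u).2 = r (u.1 - u.2) - u.1.
Proof.
rewrite /= r_minusE !(linearD, linearN) /=; apply: sp_ext => Y.
by rewrite !spE; field.
Qed.

Lemma drd1E u v : (drd u v).1 = 2^-1 *:
  (br (r (u.1 - u.2) - u.2) v.1 + br u.1 (r (v.1 - v.2) - v.2)).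
Proof. by rewrite -!rd1E. Qed.

Lemma drd2E u v : (drd u v).2 = 2^-1 *:
  (br (r (u.1 - u.2) - u.1) v.2 + br u.2 (r (v.1 - v.2) - v.1)).
Proof. by rewrite -!rd2E. Qed.

(** The diagonal annihilates itself, so the difference of the components is
    what pairing with the diagonal sees; it depends only on [u.1 - u.2] and
    [v.1 - v.2], through the bracket [br_star]. *)
Lemma drd_sub u v : (drd u v).1 - (drd u v).2
  = 2^-1 *: (br (r (u.1 - u.2)) (v.1 - v.2) + br (u.1 - u.2) (r (v.1 - v.2))).
Proof.
rewrite drd1E drd2E; move: (r _) (r _) => a b.
by apply: sp_ext => Y; rewrite !(brE, spE); field.
Qed.

Lemma dual_pairing_g e : e = 1 \/ e = -1 ->
  dual_pairing e (@emb_g R g) (@br_star R g)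
    (fun x X => e * spd (emb_gs x) (emb_g X)).
Proof.
move=> he; have e2 : e * e = 1 by case: he => ->; rewrite ?mulrNN mulr1.
have e0 : e != 0 by case: he => ->; rewrite ?oppr_eq0 oner_eq0.
split.
- move=> X h; apply: sp_nondeg => Y; have /eqP := h Y.
  by rewrite spd_emb_gs_g mulf_eq0 (negbTE e0) => /eqP.
- move=> X h; apply: sp_nondeg => Y; have /eqP := h Y.
  by rewrite spd_emb_gs_g mulf_eq0 (negbTE e0) sp_sym => /eqP.
move=> x y u v hu hv X; rewrite spd_emb_gs_g.
have ux : u.1 - u.2 = e *: x.
  apply: sp_ext => Y; rewrite !spE -(spd_emb_gs_g x) -hu /spd /=; ring.
have vy : v.1 - v.2 = e *: y.
  apply: sp_ext => Y; rewrite !spE -(spd_emb_gs_g y) -hv /spd /=; ring.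
have -> A : spd A (emb_g X) = sp (A.1 - A.2) X by rewrite /spd /= !spE.
rewrite drd_sub ux vy /br_star !(linearZ, brZl, brZr) /= !spE.
by rewrite -[e in LHS]mulr1 -e2; field.
Qed.

(** Pairing with the image of [emb_gs] sees only [u.1 + u.2 - r (u.1 - u.2)],
    that is, minus [r w - p] with [w = u.1 - u.2] and [p = u.1 + u.2]. With [z],
    [q] likewise for [v], the claim is that [drd] turns the pair of these into
    the bracket of [r w - p] and [r z - q]. All terms match at once except
    [r] of the difference of components, which the modified Yang-Baxter
    equation evaluates. *)
Lemma dual_pairing_gs e : e = 1 \/ e = -1 ->
  dual_pairing e (@emb_gs R g) (@flb_br R g)
    (fun x X => - e * spd (emb_g x) (emb_gs X)).
Proof.
move=> he; have e2 : e * e = 1 by case: he => ->; rewrite ?mulrNN mulr1.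
have e0 : - e != 0 by case: he => ->; rewrite ?opprK ?oppr_eq0 oner_eq0.
split.
- move=> X h; apply: sp_nondeg => Y; have /eqP := h Y.
  by rewrite spd_emb_g_gs mulf_eq0 (negbTE e0) => /eqP.
- move=> X h; apply: sp_nondeg => Y; have /eqP := h Y.
  by rewrite spd_emb_g_gs mulf_eq0 (negbTE e0) sp_sym => /eqP.
have spgs A X : spd A (emb_gs X)
    = 2^-1 * sp (A.1 + A.2 - r (A.1 - A.2)) X.
  rewrite /spd /= r_plusE r_minusE !(linearD, linearN) /= !spE.
  by rewrite (r_skew A.1 X) (r_skew A.2 X); field.
have half x u : (forall X, spd u (emb_gs X) = - e * spd (emb_g x) (emb_gs X)) ->
    r (u.1 - u.2) - (u.1 + u.2) = (2 * e) *: x.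
  move=> hu; apply: sp_ext => X; have := hu X; rewrite spgs spd_emb_g_gs => h.
  have -> : sp (r (u.1 - u.2) - (u.1 + u.2)) X
      = - 2 * (2^-1 * sp (u.1 + u.2 - r (u.1 - u.2)) X) by rewrite !spE; field.
  by rewrite h spE; ring.
move=> x y u v /half ux /half vy X; rewrite spd_emb_g_gs spgs.
rewrite -/(drd u v); move: (drd_sub u v) ux vy.
move: (drd1E u v) (drd2E u v); set A := drd u v.
set w := u.1 - u.2; set p := u.1 + u.2; set z := v.1 - v.2; set q := v.1 + v.2.
have u1 : u.1 = 2^-1 *: (p + w).
  by apply: sp_ext => Y; rewrite /p /w !spE; field.
have u2 : u.2 = 2^-1 *: (p - w).
  by apply: sp_ext => Y; rewrite /p /w !spE; field.
have v1 : v.1 = 2^-1 *: (q + z).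
  by apply: sp_ext => Y; rewrite /q /z !spE; field.
have v2 : v.2 = 2^-1 *: (q - z).
  by apply: sp_ext => Y; rewrite /q /z !spE; field.
rewrite u1 u2 v1 v2 => A1 A2 AB ux vy.
(* The modified Yang-Baxter equation enters here. *)
have rAB : r (A.1 - A.2) = 2^-1 *: (br (r w) (r z) + br w z).
  rewrite AB linearZ /=; congr (_ *: _); have /eqP := r_mcybe w z.
  by rewrite subr_eq => /eqP ->; rewrite addrAC addNr add0r.
have ee : sp (br x y) X = 4^-1 * sp (br (r w - p) (r z - q)) X.
  by rewrite ux vy !(brZl, brZr, spZl) -[LHS]mul1r -[X in X * _ = _]e2; field.
rewrite rAB A1 A2 ee !(brE, spE).
by field.
Qed.

End DoubleAlgebra.

(** * Representation of linear forms, and the twist *)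

Section Duality.
Context {R : realType} (g : factLieBialgebra R).
Local Notation d := (g * g)%type.

(** The pairings with a basis embed the double linearly into row vectors of
    the same dimension; the embedding is therefore onto. *)
Lemma spd_riesz (l : d -> R) : scalar l -> exists u, forall xi, spd u xi = l xi.
Proof.
move=> ll; pose n := \dim {:d}; pose b := vbasis {:d}.
have f_lin : linear (fun u : d => \row_(i < n) spd u b`_i).
  by move=> k u v; apply/rowP => i; rewrite !mxE spdDl spdZl.
pose fl : {linear d -> 'rV[R]_n} :=
  HB.pack (fun u : d => \row_(i < n) spd u b`_i) (GRing.isLinear.Build _ _ _ _ _ f_lin).
pose f := linfun fl.
have fE u i : f u 0 i = spd u b`_i by rewrite lfunE mxE.
have lD u v : l (u + v) = l u + l v by have := ll 1 u v; rewrite scale1r mul1r.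
have l0 : l 0 = 0 by have := lD 0 0; rewrite addr0 -{1}[l 0]addr0 => /addrI.
have lZ k u : l (k *: u) = k * l u by have := ll k u 0; rewrite !addr0 l0 addr0.
have expand (h : d -> R) (hD : {morph h : x y / x + y}) (h0 : h 0 = 0)
    (hZ : forall k u, h (k *: u) = k * h u) xi :
    h xi = \sum_(i < n) coord b i xi * h b`_i.
  rewrite {1}(coord_vbasis (memvf xi)) (big_morph h hD h0).
  by apply: eq_bigr => i _; rewrite hZ.
have sE u xi : spd u xi = \sum_(i < n) coord b i xi * spd u b`_i.
  apply: (expand (spd u)); [exact: spdDr| |by move=> k v; exact: spdZr].
  by rewrite -(scale0r (0 : d)) spdZr mul0r.
have kf : lker f == 0%VS.
  apply/lker0P => u v fuv; apply: spd_ext => xi; rewrite !sE.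
  by apply: eq_bigr => i _; rewrite -!fE fuv.
have sf : limg f = fullv.
  apply/eqP; rewrite eqEdim subvf /=.
  have := limg_ker_dim f fullv; rewrite (eqP kf) capv0 dimv0 add0n => ->.
  by rewrite dimvf /dim /= mul1n.
have : (\row_(i < n) l b`_i) \in limg f by rewrite sf memvf.
move=> /memv_imgP [u _ fu]; exists u => xi; rewrite sE (expand l)//.
by apply: eq_bigr => i _; rewrite -fE -fu mxE.
Qed.

End Duality.

Section TwistAlgebra.
Context {R : realType} (g : factLieBialgebra R) (s : 'End(g)).
Hypothesis hsp : forall X Y : g, flb_sp (s X) (s Y) = flb_sp X Y.
Local Notation d := (g * g)%type.

(** The tangent map of [twist]. *)
Definition twd (xi : d) : d := ((s^-1)%VF xi.1, xi.2).

Lemma ker_isometry : lker s == 0%VS.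
Proof.
apply/lker0P => X Y sXY; apply: sp_ext => Z.
by rewrite -hsp sXY hsp.
Qed.

Lemma isometryK : cancel s (s^-1)%VF.
Proof. exact: lker0_lfunK ker_isometry. Qed.

Lemma isometryVK : cancel (s^-1)%VF s.
Proof. exact: lker0_lfunVK ker_isometry. Qed.

Lemma twdZ k xi : twd (k *: xi) = k *: twd xi.
Proof. by rewrite /twd linearZ. Qed.

Lemma twdD xi eta : twd (xi + eta) = twd xi + twd eta.
Proof. by rewrite /twd /= linearD. Qed.

Lemma twdN xi : twd (- xi) = - twd xi.
Proof. by rewrite /twd /= linearN. Qed.

Lemma spd_twd xi eta : spd (twd xi) (twd eta) = spd xi eta.
Proof. by rewrite /spd /= -hsp !isometryVK. Qed.

Lemma rd_twd xi : rd_twisted s (twd xi) = twd (rd xi).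
Proof. by rewrite /rd_twisted /= isometryVK; case: xi. Qed.

Lemma twd_surj xi : exists eta, xi = twd eta.
Proof. by exists (s xi.1, xi.2); rewrite /twd /= isometryK; case: xi. Qed.

Lemma rd_twisted_skew xi eta :
  spd (rd_twisted s xi) eta = - spd xi (rd_twisted s eta).
Proof.
have [u ->] := twd_surj xi; have [v ->] := twd_surj eta.
by rewrite !rd_twd !spd_twd rd_skew.
Qed.

End TwistAlgebra.

(** * Products of Lie groups *)

Section ProductGroup.
Context {R : realType}.

Lemma prod_smooth_group (A B : topGroupType) m n (a : atlas R A m) (b : atlas R B n) :
  smooth_group a -> smooth_group b -> smooth_group (prod_atlas a b).
Proof.
move=> sa sb; have [ga _ _] := sa; have [gb _ _] := sb.
have gab := prod_good ga gb; have gg := prod_good gab gab.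
split=> // [p|x].
  apply: (@smooth_map_at_pair _ _ _ _ _ _ _ _ _ _
    (fun p : (A * B) * (A * B) => (p.1.1 * p.2.1)%g) (fun p => (p.1.2 * p.2.2)%g)).
    apply: (smooth_mul sa gg).
      apply: (smooth_map_at_comp gg gab (h := fst) (f := fst)).
        exact: smooth_map_at_fst.
      exact: smooth_map_at_fst.
    apply: (smooth_map_at_comp gg gab (h := snd) (f := fst)).
      exact: smooth_map_at_snd.
    exact: smooth_map_at_fst.
  apply: (smooth_mul sb gg).
    apply: (smooth_map_at_comp gg gab (h := fst) (f := snd)).
      exact: smooth_map_at_fst.
    exact: smooth_map_at_snd.
  apply: (smooth_map_at_comp gg gab (h := snd) (f := snd)).
    exact: smooth_map_at_snd.
  exact: smooth_map_at_snd.
apply: (@smooth_map_at_pair _ _ _ _ _ _ _ _ _ _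
    (fun x : A * B => x.1^-1%g) (fun x => x.2^-1%g)).
  by apply: (smooth_inv sa gab); exact: smooth_map_at_fst.
by apply: (smooth_inv sb gab); exact: smooth_map_at_snd.
Qed.

Lemma prod_exp_map (A B : topGroupType) m n (a : atlas R A m) (b : atlas R B n)
    (v w : vectType R) (eA : v -> A) (eB : w -> B) :
  exp_map a eA -> exp_map b eB ->
  exp_map (prod_atlas a b) (fun xi : v * w => (eA xi.1, eB xi.2) : A * B).
Proof.
move=> [ha ca ta] [hb cb tb]; split.
- by move=> s t X; congr (_, _); [exact: ha|exact: hb].
- by move=> X; exact: (cvg_pair (ca X.1) (cb X.2)).
move=> _ [c1 [c2 [ac1 bc2 ->]]] [d1 d2].
have [L [lL [L' LK L'K] dL]] := ta c1 ac1 d1.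
have [M [lM [M' MK M'K] dM]] := tb c2 bc2 d2.
exists (fun xi => row_mx (L xi.1) (M xi.2)); split.
- by move=> k X Y /=; rewrite lL lM scale_row_mx add_row_mx.
- exists (fun u => (L' (lsubmx u), M' (rsubmx u))).
    by move=> [X Y] /=; rewrite row_mxKl row_mxKr LK MK.
  by move=> u /=; rewrite L'K M'K hsubmxK.
- by move=> X; exact: (is_derive_row_mx (dL X.1) (dM X.2)).
Qed.

End ProductGroup.

(** * Homomorphisms and their tangent maps *)

Section Homs.
Context {R : realType}.

(** [l] is the tangent map of [f] at 1: homogeneity makes [f] send
    one-parameter subgroups to one-parameter subgroups. *)
Definition lie_hom (A B : topGroupType) m n (a : atlas R A m) (b : atlas R B n)
    (v w : vectType R) (eA : v -> A) (eB : w -> B) (f : A -> B) (l : v -> w) :=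
  [/\ {morph f : x y / (x * y)%g}, forall x, smooth_map_at a b f x,
      forall X, f (eA X) = eB (l X) & forall k X, l (k *: X) = k *: l X].

Lemma morph1 (A B : topGroupType) (f : A -> B) :
  {morph f : x y / (x * y)%g} -> f 1%g = 1%g.
Proof. by move=> fM; apply: (mulgI (f 1%g)); rewrite -fM !mulg1. Qed.

Lemma morphV (A B : topGroupType) (f : A -> B) :
  {morph f : x y / (x * y)%g} -> {morph f : x / x^-1%g}.
Proof.
by move=> fM x; apply: (mulgI (f x)); rewrite -fM !mulgV (morph1 fM).
Qed.

Section OneHom.
Context (A B : topGroupType) m n (a : atlas R A m) (b : atlas R B n)
  (v w : vectType R) (eA : v -> A) (eB : w -> B) (f : A -> B) (l : v -> w).
Hypotheses (sa : smooth_group a) (sb : smooth_group b)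
  (ea : exp_map a eA) (eb : exp_map b eB) (hf : lie_hom a b eA eB f l).

Lemma lie_hom_vel p X : has_vel a eA p X -> has_vel b eB (f \o p) (l X).
Proof. by case: hf => _ sf fe lZ; exact: has_vel_hom. Qed.

(** Both sides are the velocity of the image of a conjugated one-parameter
    subgroup. For a subgroup of the double, this says that the adjoint action
    of its elements preserves its Lie algebra. *)
Lemma lie_hom_Ad x X : Ad b eB (f x) (l X) = l (Ad a eA x X).
Proof.
have [fM _ _ _] := hf.
have h1 := lie_hom_vel (has_vel_Ad sa ea x (has_vel_exp sa ea X)).
have h2 := has_vel_Ad sb eb (f x) (lie_hom_vel (has_vel_exp sa ea X)).
apply: (has_vel_unique sb eb h2).
suff -> : (fun t => f x * (f \o (fun t : R => eA (t *: X))) t * (f x)^-1)%g =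
  f \o (fun t => x * eA (t *: X) * x^-1)%g by [].
by apply/funext => t; rewrite /= !fM (morphV fM).
Qed.

End OneHom.

Lemma lie_hom_comp (A B C : topGroupType) m n o (a : atlas R A m)
    (b : atlas R B n) (c : atlas R C o) (v w z : vectType R) (eA : v -> A)
    (eB : w -> B) (eC : z -> C) (f : A -> B) (h : B -> C) l k :
  good_atlas a -> good_atlas b ->
  lie_hom a b eA eB f l -> lie_hom b c eB eC h k ->
  lie_hom a c eA eC (h \o f) (k \o l).
Proof.
move=> ga gb [fM sf fe lZ] [hM sh he kZ]; split.
- by move=> x y; rewrite /= fM hM.
- by move=> x; exact: (smooth_map_at_comp ga gb (sf x) (sh (f x))).
- by move=> X; rewrite /= fe he.
- by move=> t X; rewrite /= lZ kZ.
Qed.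

End Homs.

(** * Gradients on the double *)

Section Gradients.
Context {R : realType} (g : factLieBialgebra R) (G : lieGroup R) (ex : g -> G).
Hypotheses (hG : is_lie_exp (@flb_br R g) ex) (hAd : Ad_invariant ex).
Local Notation d := (g * g)%type.
Local Notation D := (G * G)%type.
Local Notation aG := (lie_atlas G).
Local Notation aD := (double_atlas G).
Local Notation eD := (exd ex).
Local Notation AdD := (Ad aD eD).
Local Notation vel := (has_vel aD eD).
Implicit Types (x y : D) (xi eta u v : d) (p : R -> D) (phi psi : D -> R).

Lemma smooth_double : smooth_group aD.
Proof. by apply: prod_smooth_group; exact: lie_smooth_group. Qed.

Lemma exp_double : exp_map aD eD.
Proof.
by have := prod_exp_map (lie_exp_map hG) (lie_exp_map hG); exact.
Qed.

Lemma good_double : good_atlas aD. Proof. by case: smooth_double. Qed.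

Let ga : good_atlas aG := manifold_good (lie_manifold G).
Let sD := smooth_double.
Let eDm := exp_double.

Lemma fst_hom : lie_hom aD aG eD ex fst fst.
Proof. by split=> // x; exact: smooth_map_at_fst. Qed.

Lemma snd_hom : lie_hom aD aG eD ex snd snd.
Proof. by split=> // x; exact: smooth_map_at_snd. Qed.

Lemma diag_hom : lie_hom aG aD ex eD (@diagD R G) (@emb_g R g).
Proof.
split=> // x.
by apply: (@smooth_map_at_pair _ _ _ _ _ _ _ _ _ _ id id); exact: smooth_map_at_id.
Qed.

(** The two projections are homomorphisms, so the adjoint action of the double
    is componentwise. *)
Lemma Ad_invariant_double x xi eta : spd (AdD x xi) (AdD x eta) = spd xi eta.
Proof.
have key (y : G) (X Y : g) : flb_sp (Ad aG ex y X) (Ad aG ex y Y) = flb_sp X Y.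
  have sG := lie_smooth_group G; have eG := lie_exp_map hG.
  by apply: (hAd (x := y)); exact: (has_vel_Ad sG eG _ (has_vel_exp sG eG _)).
have e1 zeta : (AdD x zeta).1 = Ad aG ex x.1 zeta.1.
  by rewrite (lie_hom_Ad sD (lie_smooth_group G) eDm (lie_exp_map hG) fst_hom).
have e2 zeta : (AdD x zeta).2 = Ad aG ex x.2 zeta.2.
  by rewrite (lie_hom_Ad sD (lie_smooth_group G) eDm (lie_exp_map hG) snd_hom).
by rewrite /spd !e1 !e2 !key.
Qed.

Lemma spd_Ad x u xi : spd u (AdD x xi) = spd (AdD x^-1%g u) xi.
Proof. by rewrite -[RHS](Ad_invariant_double x) (AdKV sD eDm). Qed.

Lemma spd_AdV x u xi : spd u (AdD x^-1%g xi) = spd (AdD x u) xi.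
Proof. by rewrite spd_Ad invgK. Qed.

(** With [spd] nondegenerate, a vector representing the one-form along the
    translates is the gradient; this also applies to one-forms that are not
    differentials, such as Maurer-Cartan components. *)
Lemma grad_unique al x u :
  (forall xi, spd u xi = al (fun t : R => (eD (t *: xi) * x)%g)) ->
  grad ex al x = u.
Proof.
move=> h; apply: spd_ext => xi; rewrite h.
pose Q := [set u | forall xi, spd u xi = al (fun t : R => (eD (t *: xi) * x)%g)].
by have : Q (xget 0 Q) by apply: xgetPex; exists u.
Qed.

Lemma grad'_unique al x u :
  (forall xi, spd u xi = al (fun t : R => (x * eD (t *: xi))%g)) ->
  grad' ex al x = u.
Proof.
move=> h; apply: spd_ext => xi; rewrite h.
pose Q := [set u | forall xi, spd u xi = al (fun t : R => (x * eD (t *: xi))%g)].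
by have : Q (xget 0 Q) by apply: xgetPex; exists u.
Qed.

(** A gradient computes the derivative along any curve with the given
    velocity, which absorbs the reparametrizations [Ad] and inversion create. *)
Lemma gradP phi x p xi : smooth_at aD phi x -> vel p xi ->
  derive1 (fun t => phi (p t * x)%g) 0 = spd (grad ex (dfun phi) x) xi.
Proof.
move=> sphi pxi.
have sf : smooth_at aD (fun z => phi (z * x)%g) 1%g.
  by apply: (smooth_translr sD); rewrite mul1g.
rewrite (has_vel_derive1 sD eDm sf pxi).
have [u hu] := spd_riesz (derive1_exp_linear sD eDm sf).
have -> : grad ex (dfun phi) x = u by apply: grad_unique => eta; rewrite hu.
by rewrite hu.
Qed.

Lemma grad'P phi x p xi : smooth_at aD phi x -> vel p xi ->
  derive1 (fun t => phi (x * p t)%g) 0 = spd (grad' ex (dfun phi) x) xi.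
Proof.
move=> sphi pxi.
have sf : smooth_at aD (fun z => phi (x * z)%g) 1%g.
  by apply: (smooth_transll sD); rewrite mulg1.
rewrite (has_vel_derive1 sD eDm sf pxi).
have [u hu] := spd_riesz (derive1_exp_linear sD eDm sf).
have -> : grad' ex (dfun phi) x = u by apply: grad'_unique => eta; rewrite hu.
by rewrite hu.
Qed.

(** [exp (t xi) x = x (x^-1 exp (t xi) x)], and [Ad x] is an isometry. *)
Lemma grad_Ad phi x : smooth_at aD phi x ->
  grad ex (dfun phi) x = AdD x (grad' ex (dfun phi) x).
Proof.
move=> sphi; apply: grad_unique => xi.
have pv := has_vel_Ad sD eDm x^-1%g (has_vel_exp sD eDm xi).
rewrite -spd_AdV -(grad'P sphi pv) /dfun; congr (derive1 _ 0).
by apply/funext => t /=; rewrite invgK !mulgA mulgV mul1g.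
Qed.

End Gradients.

(** * Poisson actions *)

Section Actions.
Context {R : realType} (g : factLieBialgebra R) (G : lieGroup R) (ex : g -> G).
Hypotheses (hG : is_lie_exp (@flb_br R g) ex) (hAd : Ad_invariant ex).
Context (sigma sigma' : G -> G) (s : 'End(g)).
Hypotheses (hsigma : is_lie_automorphism sigma sigma')
  (hs : forall X, sigma (ex X) = ex (s X))
  (hsp : forall X Y : g, flb_sp (s X) (s Y) = flb_sp X Y).
Local Notation d := (g * g)%type.
Local Notation D := (G * G)%type.
Local Notation aG := (lie_atlas G).
Local Notation aD := (double_atlas G).
Local Notation eD := (exd ex).
Local Notation AdD := (Ad aD eD).
Local Notation vel := (has_vel aD eD).
Local Notation tw := (twist sigma').
Implicit Types (x y : D) (xi eta u v : d) (p : R -> D) (phi psi : D -> R).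

Let ga : good_atlas aG := manifold_good (lie_manifold G).
Let sD := smooth_double G.
Let eDm := exp_double hG.
Let gD := good_double G.

Lemma twist_hom : lie_hom aD aD eD eD tw (twd s).
Proof.
have [sM sK Ks ss ss'] := hsigma; split.
- move=> x y; congr (_, _) => /=; apply: (can_inj sK).
  by rewrite sM !Ks.
- move=> x.
  apply: (@smooth_map_at_pair _ _ _ _ _ _ _ _ _ _ (sigma' \o fst) snd).
    apply: (smooth_map_at_comp gD ga); first exact: smooth_map_at_fst.
    have /smooth_map_onP := ss'; apply=> //; exact: openT.
  exact: smooth_map_at_snd.
- move=> X; congr (_, _); apply: (can_inj sK).
  by rewrite Ks hs isometryVK.
- exact: twdZ.
Qed.

(** The transpose of [twd s] with respect to [spd]. *)
Definition twdV (xi : d) : d := (s xi.1, xi.2).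

Lemma spd_twdV u xi : spd (twdV u) xi = spd u (twd s xi).
Proof.
rewrite -(spd_twd hsp); congr (spd _ _).
by rewrite /twd /twdV /= (isometryK hsp); case: u.
Qed.

Lemma rd_twdV u v : spd (rd (twdV u)) (twdV v) = spd (rd_twisted s u) v.
Proof. by rewrite spdC spd_twdV spdC. Qed.

Lemma rdNN u v : spd (rd (- u)) (- v) = spd (rd u) v.
Proof. by rewrite rdN spdNl spdNr opprK. Qed.

Lemma smooth_double_at phi x : smooth_on aD setT phi -> smooth_at aD phi x.
Proof.
have [ca _ _] := gD => /smooth_onP h.
by apply: h => //; exact: openT.
Qed.

(** In [{phi o L, psi o L}] the point contributes the left gradient term at
    [y = x k] and the right gradient term moved to [x] by [Ad k]; the group
    element contributes the right gradient term at [y] and, with the opposite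
    sign, the moved one, which cancels. *)
Lemma actL_bracket phi psi x b :
  smooth_on aD setT phi -> smooth_on aD setT psi ->
  - br_double ex (fun b => phi (actL sigma' (b, x)))
                 (fun b => psi (actL sigma' (b, x))) b
  + br_twisted ex s (fun x => phi (actL sigma' (b, x)))
                    (fun x => psi (actL sigma' (b, x))) x
  = br_twisted ex s phi psi (actL sigma' (b, x)).
Proof.
rewrite /actL /=; move kE: (tw b)^-1%g => k sphi spsi.
have [twM _ twE _] := twist_hom.
have velT xi := lie_hom_vel sD eDm twist_hom (has_vel_exp sD eDm xi).
have key chi : smooth_on aD setT chi ->
  [/\ grad ex (dfun (fun x => chi (x * k)%g)) x = grad ex (dfun chi) (x * k)%g,
      grad' ex (dfun (fun x => chi (x * k)%g)) x = AdD k (grad' ex (dfun chi) (x * k)%g),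
      grad ex (dfun (fun b => chi (x * (tw b)^-1)%g)) b
        = - twdV (grad' ex (dfun chi) (x * k)%g) &
      grad' ex (dfun (fun b => chi (x * (tw b)^-1)%g)) b
        = - twdV (AdD k (grad' ex (dfun chi) (x * k)%g))].
  move=> schi; have sc : smooth_at aD chi (x * k)%g by exact: smooth_double_at.
  split.
  - apply: grad_unique => xi; rewrite -(gradP hG sc (has_vel_exp sD eDm xi)) /dfun.
    by congr (derive1 _ 0); apply/funext => t /=; rewrite mulgA.
  - apply: (grad'_unique) => xi.
    have pv := has_vel_Ad sD eDm k^-1%g (has_vel_exp sD eDm xi).
    rewrite -(spd_AdV hG hAd) -(grad'P hG sc pv) /dfun.
    congr (derive1 _ 0); apply/funext => t /=.
    by rewrite invgK !mulgA mulgK.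
  - apply: grad_unique => xi; rewrite spdNl spd_twdV -spdNr.
    rewrite -(grad'P hG sc (has_velV sD eDm (velT xi))) /dfun.
    congr (derive1 _ 0); apply/funext => t /=.
    by rewrite twM invgM kE !mulgA.
  - apply: grad'_unique => xi; rewrite spdNl spd_twdV -spdNr -(spd_AdV hG hAd).
    have pv := has_vel_Ad sD eDm k^-1%g (has_velV sD eDm (velT xi)).
    rewrite -(grad'P hG sc pv) /dfun.
    congr (derive1 _ 0); apply/funext => t /=.
    by rewrite twM invgM kE invgK !mulgA mulgK.
have [a1 a2 a3 a4] := key _ sphi; have [b1 b2 b3 b4] := key _ spsi.
rewrite /br_double /br_twisted /pi_double /pi_twisted.
rewrite a1 a2 a3 a4 b1 b2 b3 b4 !rdNN !rd_twdV.
have cancel (A B C : R) : - (- A + B) + (C + B) = C + A by ring.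
exact: cancel.
Qed.

(** As for [actL_bracket], with the roles of the two gradients exchanged: the
    twisted term is invariant under left translation, and the moved left
    gradient term is the one that cancels. *)
Lemma actR_bracket phi psi x b :
  smooth_on aD setT phi -> smooth_on aD setT psi ->
  br_twisted ex s (fun x => phi (actR (x, b))) (fun x => psi (actR (x, b))) x
  + br_double ex (fun b => phi (actR (x, b))) (fun b => psi (actR (x, b))) b
  = br_twisted ex s phi psi (actR (x, b)).
Proof.
rewrite /actR /=; move kE: b^-1%g => k sphi spsi.
have key chi : smooth_on aD setT chi ->
  [/\ grad ex (dfun (fun x => chi (k * x)%g)) x = AdD k^-1%g (grad ex (dfun chi) (k * x)%g),
      grad' ex (dfun (fun x => chi (k * x)%g)) x = grad' ex (dfun chi) (k * x)%g,
      grad ex (dfun (fun b => chi (b^-1 * x)%g)) b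
        = - AdD k^-1%g (grad ex (dfun chi) (k * x)%g) &
      grad' ex (dfun (fun b => chi (b^-1 * x)%g)) b
        = - (grad ex (dfun chi) (k * x)%g)].
  move=> schi; have sc : smooth_at aD chi (k * x)%g by exact: smooth_double_at.
  split.
  - apply: grad_unique => xi.
    have pv := has_vel_Ad sD eDm k (has_vel_exp sD eDm xi).
    rewrite -(spd_Ad hG hAd) -(gradP hG sc pv) /dfun.
    congr (derive1 _ 0); apply/funext => t /=.
    by rewrite !mulgA mulgVK.
  - apply: grad'_unique => xi; rewrite -(grad'P hG sc (has_vel_exp sD eDm xi)) /dfun.
    by congr (derive1 _ 0); apply/funext => t /=; rewrite mulgA.
  - apply: grad_unique => xi; rewrite spdNl -spdNr -(spd_Ad hG hAd).
    have pv := has_vel_Ad sD eDm k (has_velV sD eDm (has_vel_exp sD eDm xi)).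
    rewrite -(gradP hG sc pv) /dfun.
    congr (derive1 _ 0); apply/funext => t /=.
    by rewrite invgM kE !mulgA mulgVK.
  - apply: grad'_unique => xi; rewrite spdNl -spdNr.
    rewrite -(gradP hG sc (has_velV sD eDm (has_vel_exp sD eDm xi))) /dfun.
    congr (derive1 _ 0); apply/funext => t /=.
    by rewrite invgM kE mulgA.
have [a1 a2 a3 a4] := key _ sphi; have [b1 b2 b3 b4] := key _ spsi.
rewrite /br_double /br_twisted /pi_double /pi_twisted.
rewrite a1 a2 a3 a4 b1 b2 b3 b4 !rdNN.
have cancel (A B C : R) : A + B + (- A + C) = C + B by ring.
exact: cancel.
Qed.

Section Subgroup.
Context (A : topGroupType) m (a : atlas R A m) (bA : pbracket R A) (j : A -> D).
Hypotheses (gA : good_atlas a) (jM : {morph j : x y / (x * y)%g})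
  (jP : is_poisson_map a aD bA (br_double ex) j).

Lemma smooth_subgroup (y : A) : smooth_map_at a aD j y.
Proof.
have [sj _] := jP; have /smooth_map_onP := sj.
by apply=> //; exact: openT.
Qed.

(** The group element enters through [j], a Poisson map, so its contribution
    is the one of the double, evaluated on the functions [b |-> chi (x (T b)^-1)]. *)
Lemma left_action_subgroup :
  left_poisson_action a aD (opp_bracket bA) (br_twisted ex s)
    (fun q : A * D => actL sigma' (j q.1, q.2)).
Proof.
have [twM tws _ _] := twist_hom; have gp := prod_good gA gD.
split.
- by move=> x; rewrite /actL /= (morph1 jM) (morph1 twM) invg1 mulg1.
- by move=> x y z; rewrite /actL /= jM twM invgM mulgA.
split.
  apply/smooth_map_onP => //; first exact: openT.
  move=> p _; apply: (smooth_mul sD gp); first exact: smooth_map_at_snd.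
  apply: (smooth_inv sD gp).
  apply: (smooth_map_at_comp gp gD (f := tw) (h := j \o fst)); last exact: tws.
  apply: (smooth_map_at_comp gp gA); last exact: smooth_subgroup.
  exact: smooth_map_at_fst.
move=> phi psi sphi spsi [y x].
have sc (chi : D -> R) : smooth_on aD setT chi ->
    smooth_on aD setT (fun b => chi (actL sigma' (b, x))).
  move=> schi; have [ca _ _] := gD; apply/smooth_onP => //; first exact: openT.
  move=> b _; apply: (smooth_at_comp gD gD (h := fun b => actL sigma' (b, x)) (f := chi) _ (smooth_double_at schi)).
  apply: (smooth_mul sD gD); first exact: smooth_map_at_cst.
  by apply: (smooth_inv sD gD); exact: tws.
rewrite -(actL_bracket x (j y) sphi spsi) /prod_bracket /opp_bracket /=.
congr (- _ + _); have [_ jb] := jP.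
exact: (jb _ _ (sc _ sphi) (sc _ spsi) y).
Qed.

Lemma right_action_subgroup :
  right_poisson_action a aD bA (br_twisted ex s)
    (fun q : D * A => actR (q.1, j q.2)).
Proof.
have gp := prod_good gD gA.
split.
- by move=> x; rewrite /actR /= (morph1 jM) invg1 mul1g.
- by move=> x y z; rewrite /actR /= jM invgM mulgA.
split.
  apply/smooth_map_onP => //; first exact: openT.
  move=> p _; apply: (smooth_mul sD gp); last exact: smooth_map_at_fst.
  apply: (smooth_inv sD gp).
  apply: (smooth_map_at_comp gp gA (f := j)); last exact: smooth_subgroup.
  exact: smooth_map_at_snd.
move=> phi psi sphi spsi [x y].
have sc (chi : D -> R) : smooth_on aD setT chi ->
    smooth_on aD setT (fun b => chi (actR (x, b))).
  move=> schi; have [ca _ _] := gD; apply/smooth_onP => //; first exact: openT.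
  move=> b _; apply: (smooth_at_comp gD gD (h := fun b => actR (x, b)) (f := chi) _ (smooth_double_at schi)).
  apply: (smooth_mul sD gD); last exact: smooth_map_at_cst.
  by apply: (smooth_inv sD gD); exact: smooth_map_at_id.
rewrite -(actR_bracket x (j y) sphi spsi) /prod_bracket /=.
congr (_ + _); have [_ jb] := jP.
exact: (jb _ _ (sc _ sphi) (sc _ spsi) y).
Qed.

End Subgroup.

End Actions.

(** * Velocities of the factors of a factorization *)

Section Factors.
Context {R : realType} (A B D : topGroupType) m n o (a : atlas R A m)
  (b : atlas R B n) (c : atlas R D o) (v w z : vectType R)
  (eA : v -> A) (eB : w -> B) (eD : z -> D)
  (f : A -> D) (h : B -> D) (l : v -> z) (k : w -> z).
Hypotheses (sa : smooth_group a) (sb : smooth_group b) (sc : smooth_group c)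
  (ea : exp_map a eA) (eb : exp_map b eB) (ec : exp_map c eD)
  (hf : lie_hom a c eA eD f l) (hh : lie_hom b c eB eD h k).
Context (U : set D) (fa : D -> A) (fb : D -> B).
Hypotheses (oU : open U) (sfa : forall x, U x -> smooth_map_at c a fa x)
  (sfb : forall x, U x -> smooth_map_at c b fb x)
  (fab : forall x, U x -> x = (f (fa x) * h (fb x))%g).

Let ga : good_atlas a. Proof. by case: sa. Qed.
Let gb : good_atlas b. Proof. by case: sb. Qed.
Let gc : good_atlas c. Proof. by case: sc. Qed.

Lemma near_in_open (q : R -> D) : curve_at c q -> U (q 0) ->
  \forall t \near (0 : R), U (q t).
Proof. by move=> [cq _] Uq; apply: cq; exact: open_nbhs_nbhs. Qed.

(** With [x = f (fa x) h (fb x)] along the curve, [x^-1 q] is the conjugate by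
    [h (fb x)] of the logarithmic velocity of the first factor, times that of
    the second one. Since [eta] is arbitrary, the two Lie algebras, one of them
    moved by [Ad], span the Lie algebra of [D]. *)
Lemma left_factor_velocity x q eta : U x -> q 0 = x ->
  has_vel c eD (fun t => x^-1 * q t)%g eta ->
  exists Y X, [/\ has_vel a eA (fun t => (fa (q 0))^-1 * fa (q t))%g Y,
    has_vel b eB (fun t => (fb (q 0))^-1 * fb (q t))%g X &
    eta = Ad c eD (h (fb x))^-1%g (l Y) + k X].
Proof.
move=> Ux q0 qeta; have [fM _ _ _] := hf; have [hM _ _ _] := hh.
have cq : curve_at c q.
  have := curve_trans sc x 1%g (has_vel_curve qeta).
  by rewrite (_ : (fun t => _) = q)//; apply/funext => t; rewrite mulVKg mulg1.
have cfa : curve_at a (fa \o q).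
  by apply: (curve_at_comp gc cq); rewrite q0; exact: sfa.
have cfb : curve_at b (fb \o q).
  by apply: (curve_at_comp gc cq); rewrite q0; exact: sfb.
have [Y aY] : exists Y, has_vel a eA (fun t => (fa (q 0))^-1 * fa (q t))%g Y.
  apply: (has_vel_exists sa ea); last by rewrite mulVg.
  have := curve_trans sa (fa (q 0))^-1%g 1%g cfa.
  by congr curve_at; apply/funext => t; rewrite mulg1.
have [X bX] : exists X, has_vel b eB (fun t => (fb (q 0))^-1 * fb (q t))%g X.
  apply: (has_vel_exists sb eb); last by rewrite mulVg.
  have := curve_trans sb (fb (q 0))^-1%g 1%g cfb.
  by congr curve_at; apply/funext => t; rewrite mulg1.
exists Y, X; split=> //.
have v1 := has_vel_Ad sc ec (h (fb x))^-1%g (lie_hom_vel sa ea hf aY).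
have v2 := lie_hom_vel sb eb hh bX.
apply: (has_vel_unique sc ec qeta).
apply: same_velocity_near (has_velM sc ec v1 v2).
have Uq0 : U (q 0) by rewrite q0.
apply: filterS (near_in_open cq Uq0) => t Uqt /=.
rewrite q0 fM hM (morphV fM) (morphV hM) invgK [in RHS](fab Uqt) [in RHS](fab Ux).
by rewrite invgM !mulgA mulgK.
Qed.

Lemma right_factor_velocity x q xi : U x -> q 0 = x ->
  has_vel c eD (fun t => q t * x^-1)%g xi ->
  exists Y X, [/\ has_vel b eB (fun t => fb (q t) * (fb (q 0))^-1)%g Y,
    has_vel a eA (fun t => fa (q t) * (fa (q 0))^-1)%g X &
    xi = l X + Ad c eD (f (fa x)) (k Y)].
Proof.
move=> Ux q0 qeta; have [fM _ _ _] := hf; have [hM _ _ _] := hh.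
have cq : curve_at c q.
  have := curve_trans sc 1%g x (has_vel_curve qeta).
  by rewrite (_ : (fun t => _) = q)//; apply/funext => t; rewrite mul1g mulgVK.
have cfa : curve_at a (fa \o q).
  by apply: (curve_at_comp gc cq); rewrite q0; exact: sfa.
have cfb : curve_at b (fb \o q).
  by apply: (curve_at_comp gc cq); rewrite q0; exact: sfb.
have [X aX] : exists X, has_vel a eA (fun t => fa (q t) * (fa (q 0))^-1)%g X.
  apply: (has_vel_exists sa ea); last by rewrite mulgV.
  have := curve_trans sa 1%g (fa (q 0))^-1%g cfa.
  by congr curve_at; apply/funext => t; rewrite mul1g.
have [Y bY] : exists Y, has_vel b eB (fun t => fb (q t) * (fb (q 0))^-1)%g Y.
  apply: (has_vel_exists sb eb); last by rewrite mulgV.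
  have := curve_trans sb 1%g (fb (q 0))^-1%g cfb.
  by congr curve_at; apply/funext => t; rewrite mul1g.
exists Y, X; split=> //.
have v1 := lie_hom_vel sa ea hf aX.
have v2 := has_vel_Ad sc ec (f (fa x)) (lie_hom_vel sb eb hh bY).
apply: (has_vel_unique sc ec qeta).
apply: same_velocity_near (has_velM sc ec v1 v2).
have Uq0 : U (q 0) by rewrite q0.
apply: filterS (near_in_open cq Uq0) => t Uqt /=.
rewrite q0 fM hM (morphV fM) (morphV hM) [in RHS](fab Uqt) [in RHS](fab Ux).
by rewrite invgM !mulgA mulgVK.
Qed.

End Factors.

(** * Moment maps *)

Lemma mc_leftE (R : realType) (K : lieGroup R) (k : vectType R) br (e : k -> K)
    (c : R -> K) X :
  is_lie_exp br e ->
  has_vel (lie_atlas K) e (fun t => (c 0)^-1 * c t)%g X -> mc_left e c = X.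
Proof.
move=> he cX; pose Q := [set X | has_vel (lie_atlas K) e (fun t => (c 0)^-1 * c t)%g X].
have QX : Q (xget 0 Q) by apply: xgetPex; exists X.
exact: (has_vel_unique (lie_smooth_group K) (lie_exp_map he) QX cX).
Qed.

Lemma mc_rightE (R : realType) (K : lieGroup R) (k : vectType R) br (e : k -> K)
    (c : R -> K) X :
  is_lie_exp br e ->
  has_vel (lie_atlas K) e (fun t => c t * (c 0)^-1)%g X -> mc_right e c = X.
Proof.
move=> he cX; pose Q := [set X | has_vel (lie_atlas K) e (fun t => c t * (c 0)^-1)%g X].
have QX : Q (xget 0 Q) by apply: xgetPex; exists X.
exact: (has_vel_unique (lie_smooth_group K) (lie_exp_map he) QX cX).
Qed.

Section MomentMaps.
Context {R : realType} (g : factLieBialgebra R) (G : lieGroup R) (ex : g -> G).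
Hypotheses (hG : is_lie_exp (@flb_br R g) ex) (hAd : Ad_invariant ex).
Context (sigma sigma' : G -> G) (s : 'End(g)).
Hypotheses (hsigma : is_lie_automorphism sigma sigma')
  (hs : forall X, sigma (ex X) = ex (s X))
  (hsp : forall X Y : g, flb_sp (s X) (s Y) = flb_sp X Y).
Local Notation d := (g * g)%type.
Local Notation D := (G * G)%type.
Local Notation aD := (double_atlas G).
Local Notation eD := (exd ex).
Local Notation AdD := (Ad aD eD).
Local Notation vel := (has_vel aD eD).
Local Notation tw := (twist sigma').
Context (K1 K2 : lieGroup R) (br1 br2 : g -> g -> g) (e1 : g -> K1) (e2 : g -> K2)
  (f1 : K1 -> D) (f2 : K2 -> D) (j1 j2 : g -> d) (e : R).
Hypotheses (hK1 : is_lie_exp br1 e1) (hK2 : is_lie_exp br2 e2)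
  (hf1 : lie_hom (lie_atlas K1) aD e1 eD f1 j1)
  (hf2 : lie_hom (lie_atlas K2) aD e2 eD f2 j2)
  (ee : e * e = 1)
  (rd1 : forall X, rd (j1 X) = e *: j1 X)
  (rd2 : forall X, rd (j2 X) = - (e *: j2 X))
  (iso1 : forall X Y, spd (j1 X) (j1 Y) = 0)
  (iso2 : forall X Y, spd (j2 X) (j2 Y) = 0).
Context (U : set D) (oU : open U).

Let sD := smooth_double G.
Let eDm := exp_double hG.
Let gD := good_double G.
Let s1 := lie_smooth_group K1.
Let s2 := lie_smooth_group K2.
Let em1 := lie_exp_map hK1.
Let em2 := lie_exp_map hK2.
Let twH := twist_hom hsigma hs hsp.
Let g1 : good_atlas (lie_atlas K1) := manifold_good (lie_manifold K1).
Let g2 : good_atlas (lie_atlas K2) := manifold_good (lie_manifold K2).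
Let tf1 : lie_hom (lie_atlas K1) aD e1 eD (tw \o f1) (twd s \o j1) :=
  lie_hom_comp g1 gD hf1 twH.
Let tf2 : lie_hom (lie_atlas K2) aD e2 eD (tw \o f2) (twd s \o j2) :=
  lie_hom_comp g2 gD hf2 twH.

(** Here [j1] is the Lie algebra of the acting subgroup, with eigenvalue [e] of
    [rd], and [j2] the one of the dual subgroup, with eigenvalue [- e]. Split
    [e T j1 X] as [u + T j2 W] with [u] in [Ad k^-1 j1]. By isotropy of both
    summands, [spd u] takes the value [e spd (j2 X') (j1 X)] on a velocity
    whose Maurer-Cartan component in the second factor is [X'], so [u] is the
    right gradient of the one-form in question. Its left gradient [Ad x u] lies
    in [j1], where [rd] is [e], while [u = T (e j1 X - j2 W)] shows how the
    twisted [rd] acts on [u]; the terms in [W] cancel in the Poisson tensor. *)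
Lemma left_moment_map_factor (kap : g -> g -> R) (fa : D -> K1) (fb : D -> K2) :
  (forall x X, kap x X = e * spd (j2 x) (j1 X)) ->
  smooth_map_on aD (lie_atlas K1) U fa -> smooth_map_on aD (lie_atlas K2) U fb ->
  (forall x, U x -> x = (f1 (fa x) * tw (f2 (fb x)))%g) ->
  left_moment_map aD (pi_twisted ex s) U e1 e2 kap
    (fun p : K1 * D => actL sigma' (f1 p.1, p.2)) fb.
Proof.
move=> kapE sfa sfb fab; split=> // X phi sphi x Ux.
have sa : forall x, U x -> smooth_map_at aD (lie_atlas K1) fa x.
  exact: (smooth_map_onP fa gD g1 oU).1.
have sb : forall x, U x -> smooth_map_at aD (lie_atlas K2) fb x.
  exact: (smooth_map_onP fb gD g2 oU).1.
have sx : smooth_at aD phi x by have [ca _ _] := gD; exact: (smooth_onP phi ca oU).1.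
have [twM _ _ _] := twH.
have velT := has_velV sD eDm (lie_hom_vel s1 em1 tf1 (has_vel_exp s1 em1 X)).
rewrite [LHS](grad'P hG sx velT) /=.
set al := (fun c => _); set k := tw (f2 (fb x)).
have factor q eta : q 0 = x -> vel (fun t => x^-1 * q t)%g eta ->
    exists Y X', eta = AdD k^-1%g (j1 Y) + twd s (j2 X') /\
                 al q = e * spd (j2 X') (j1 X).
  move=> q0 qeta.
  have [Y [X' [_ bX' etaE]]] :=
    left_factor_velocity s1 s2 sD em1 em2 eDm hf1 tf2 oU sa sb fab Ux q0 qeta.
  by exists Y, X'; split; [exact: etaE|rewrite /al (mc_leftE hK2 bX') kapE].
(* Any curve through [x] with this velocity exhibits the splitting. *)
have [Z [W [XE _]]] : exists Y X',
    e *: twd s (j1 X) = AdD k^-1%g (j1 Y) + twd s (j2 X') /\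
    al (fun t => x * eD (t *: (e *: twd s (j1 X))))%g = e * spd (j2 X') (j1 X).
  apply: factor; first by rewrite scale0r (exp0 eDm) mulg1.
  have := has_vel_exp sD eDm (e *: twd s (j1 X)).
  by congr has_vel; apply/funext => t; rewrite mulKg.
set u := AdD k^-1%g (j1 Z) in XE.
have uE : u = e *: twd s (j1 X) - twd s (j2 W) by rewrite XE addrK.
have alE q eta : q 0 = x -> vel (fun t => x^-1 * q t)%g eta -> spd u eta = al q.
  move=> q0 /(factor q _ q0) [Y [X' [-> ->]]].
  rewrite spdDr (Ad_invariant_double hG hAd) iso1 add0r uE spdDl spdZl spdNl.
  by rewrite !(spd_twd hsp) iso2 subr0 spdC.
have gr' : grad' ex al x = u.
  apply: grad'_unique => xi; apply: alE.
    by rewrite scale0r (exp0 eDm) mulg1.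
  have := has_vel_exp sD eDm xi.
  by congr has_vel; apply/funext => t; rewrite mulKg.
have gr : grad ex al x = AdD x u.
  apply: grad_unique => xi; rewrite -(spd_AdV hG hAd); apply: alE.
    by rewrite scale0r (exp0 eDm) mul1g.
  have := has_vel_Ad sD eDm x^-1%g (has_vel_exp sD eDm xi).
  by congr has_vel; apply/funext => t; rewrite invgK mulgA.
have xu : AdD x u = j1 (Ad (lie_atlas K1) e1 (fa x) Z).
  rewrite /u -(AdM sD eDm) -(lie_hom_Ad s1 sD em1 eDm hf1); congr (Ad _ _ _ _).
  by rewrite [in LHS](fab _ Ux) mulgK.
rewrite /pi_twisted gr gr' (grad_Ad hG hAd sx).
set v := grad' ex (dfun phi) x.
have -> : spd (rd (AdD x v)) (AdD x u) = - (e * spd v u).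
  by rewrite rd_skew {1}xu rd1 -xu spdZr (Ad_invariant_double hG hAd).
have -> : spd (rd_twisted s v) u = - spd v (twd s (j1 X) + e *: twd s (j2 W)).
  rewrite (rd_twisted_skew hsp); congr (- spd _ _).
  have -> : u = twd s (e *: j1 X - j2 W).
    by rewrite uE twdD twdN twdZ.
  by rewrite (rd_twd hsp) rdD rdN rdZ rd1 rd2 scalerA ee scale1r opprK twdD twdZ.
rewrite uE !spdE -/v; set p := spd v _; set q := spd v _.
have -> : - (e * (e * p - q)) = - (e * e) * p + e * q by ring.
by rewrite ee; field.
Qed.

(** The mirror image: the left gradient [u] is the part of [e j1 X] in
    [Ad k (T j1)], and the right gradient [Ad x^-1 u] lies in [T j1]. *)
Lemma right_moment_map_factor (kap : g -> g -> R) (fa : D -> K2) (fb : D -> K1) :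
  (forall x X, kap x X = - (e * spd (j2 x) (j1 X))) ->
  smooth_map_on aD (lie_atlas K2) U fa -> smooth_map_on aD (lie_atlas K1) U fb ->
  (forall x, U x -> x = (f2 (fa x) * tw (f1 (fb x)))%g) ->
  right_moment_map aD (pi_twisted ex s) U e1 e2 kap
    (fun p : D * K1 => actR (p.1, f1 p.2)) fa.
Proof.
move=> kapE sfa sfb fab; split=> // X phi sphi x Ux.
have sa : forall x, U x -> smooth_map_at aD (lie_atlas K2) fa x.
  exact: (smooth_map_onP fa gD g2 oU).1.
have sb : forall x, U x -> smooth_map_at aD (lie_atlas K1) fb x.
  exact: (smooth_map_onP fb gD g1 oU).1.
have sx : smooth_at aD phi x by have [ca _ _] := gD; exact: (smooth_onP phi ca oU).1.
have velV := has_velV sD eDm (lie_hom_vel s1 em1 hf1 (has_vel_exp s1 em1 X)).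
rewrite [LHS](gradP hG sx velV) /=.
set al := (fun c => _); set k := f2 (fa x).
have factor q xi : q 0 = x -> vel (fun t => q t * x^-1)%g xi ->
    exists Y X', xi = j2 X' + AdD k (twd s (j1 Y)) /\
                 al q = e * spd (j2 X') (j1 X).
  move=> q0 qxi.
  have [Y [X' [_ aX' xiE]]] :=
    right_factor_velocity s2 s1 sD em2 em1 eDm hf2 tf1 oU sa sb fab Ux q0 qxi.
  by exists Y, X'; split; [exact: xiE|rewrite /al (mc_rightE hK2 aX') kapE opprK].
(* Any curve through [x] with this velocity exhibits the splitting. *)
have [Z [W [XE _]]] : exists Y X',
    e *: j1 X = j2 X' + AdD k (twd s (j1 Y)) /\
    al (fun t => eD (t *: (e *: j1 X)) * x)%g = e * spd (j2 X') (j1 X).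
  apply: factor; first by rewrite scale0r (exp0 eDm) mul1g.
  have := has_vel_exp sD eDm (e *: j1 X).
  by congr has_vel; apply/funext => t; rewrite mulgK.
set u := AdD k (twd s (j1 Z)) in XE.
have uE : u = e *: j1 X - j2 W by rewrite XE addrC addKr.
have alE q xi : q 0 = x -> vel (fun t => q t * x^-1)%g xi -> spd u xi = al q.
  move=> q0 /(factor q _ q0) [Y [X' [-> ->]]].
  rewrite spdDr (Ad_invariant_double hG hAd) (spd_twd hsp) iso1 addr0 uE spdDl.
  by rewrite spdZl spdNl iso2 subr0 spdC.
have gr : grad ex al x = u.
  apply: grad_unique => xi; apply: alE.
    by rewrite scale0r (exp0 eDm) mul1g.
  have := has_vel_exp sD eDm xi.
  by congr has_vel; apply/funext => t; rewrite mulgK.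
have gr' : grad' ex al x = AdD x^-1%g u.
  apply: grad'_unique => xi; rewrite -(spd_Ad hG hAd); apply: alE.
    by rewrite scale0r (exp0 eDm) mulg1.
  exact (has_vel_Ad sD eDm x (has_vel_exp sD eDm xi)).
set Z' := Ad (lie_atlas K1) e1 (fb x)^-1%g Z.
have xu : AdD x^-1%g u = twd s (j1 Z').
  have [fM _ _ _] := tf1.
  rewrite /u -(AdM sD eDm) -[RHS](lie_hom_Ad s1 sD em1 eDm tf1); congr (Ad _ _ _ _).
  by rewrite (morphV fM) [in LHS](fab _ Ux) invgM mulgVK.
have phiE : grad' ex (dfun phi) x = AdD x^-1%g (grad ex (dfun phi) x).
  by rewrite (grad_Ad hG hAd sx) (AdK sD eDm).
rewrite /pi_twisted gr gr' phiE.
set v := grad ex (dfun phi) x.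
have -> : spd (rd_twisted s (AdD x^-1%g v)) (AdD x^-1%g u) = - (e * spd v u).
  rewrite (rd_twisted_skew hsp) {1}xu (rd_twd hsp) rd1 twdZ -xu spdZr.
  by rewrite (Ad_invariant_double hG hAd).
have -> : spd (rd v) u = - spd v (j1 X + e *: j2 W).
  rewrite rd_skew uE; congr (- spd _ _).
  by rewrite rdD rdN rdZ rd1 rd2 scalerA ee scale1r opprK.
rewrite uE !spdE -/v; set p := spd v _; set q := spd v _.
have -> : - (e * (e * p - q)) = - (e * e) * p + e * q by ring.
by rewrite ee; field.
Qed.

End MomentMaps.

(** * Translations of the twisted Heisenberg double and their moment maps *)

Theorem proposition6 (R : realType) (g : factLieBialgebra R)
    (* the Lie group G with Lie algebra g *)
    (G : lieGroup R) (ex : g -> G)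
    (hG : is_lie_exp (@flb_br R g) ex)
    (hAd : Ad_invariant ex)
    (* the subgroup G^* of D = G x G *)
    (S : lieGroup R) (exS : g -> S) (i : S -> G * G)
    (hS : is_dual_subgroup ex exS i)
    (* G and G^* are Poisson Lie subgroups of D *)
    (bG : pbracket R G) (bS : pbracket R S)
    (hbG : is_poisson_subgroup (lie_atlas G) (double_atlas G)
             bG (br_double ex) (@diagD R G))
    (hbS : is_poisson_subgroup (lie_atlas S) (double_atlas G)
             bS (br_double ex) i)
    (* the automorphism sigma of G and the induced automorphism s of g *)
    (sigma sigma' : G -> G) (s : 'End(g))
    (hsigma : is_lie_automorphism sigma sigma')
    (hs : forall X, sigma (ex X) = ex (s X))
    (hsr : forall X, s (flb_r g X) = flb_r g (s X))
    (hsp : forall X Y, flb_sp (s X) (s Y) = flb_sp X Y) :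
  let aD := double_atlas G in
  let bD := br_double ex in
  let bDs := br_twisted ex s in
  let piDs := pi_twisted ex s in
  let L := actL sigma' in
  let L_G := fun p : G * (G * G) => L (diagD p.1, p.2) in
  let L_S := fun p : S * (G * G) => L (i p.1, p.2) in
  let R_D := @actR R G in
  let R_G := fun p : (G * G) * G => R_D (p.1, diagD p.2) in
  let R_S := fun p : (G * G) * S => R_D (p.1, i p.2) in
  (* the pairing of Lie G^* with Lie G, resp. of Lie G with Lie G^*, when the
     Poisson bracket of G, resp. of G^* as a subgroup of D, is multiplied by eps *)
  let kap_G (eps : R) (x X : g) := eps * spd (emb_gs x) (emb_g X) in
  let kap_S (eps : R) (x X : g) := - eps * spd (emb_g x) (emb_gs X) in
  (* (i) *)
  (left_poisson_action aD aD (opp_bracket bD) bDs L /\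
   right_poisson_action aD aD bD bDs R_D) /\
  (* (ii) *)
  [/\ left_poisson_action (lie_atlas G) aD (opp_bracket bG) bDs L_G,
      right_poisson_action (lie_atlas G) aD bG bDs R_G,
      left_poisson_action (lie_atlas S) aD (opp_bracket bS) bDs L_S &
      right_poisson_action (lie_atlas S) aD bS bDs R_S] /\
  (* (iii) *)
  (forall eps : R, eps = 1 \/ eps = -1 ->
     dual_pairing eps (@emb_g R g) (@br_star R g) (kap_G eps) /\
     dual_pairing eps (@emb_gs R g) (@flb_br R g) (kap_S eps)) /\
  (forall (U : set (G * G)) (a h : G * G -> G) (b c : G * G -> S),
     open U -> U `<=` principal_leaf sigma' i ->
     smooth_map_on aD (lie_atlas G) U a ->
     smooth_map_on aD (lie_atlas G) U h ->
     smooth_map_on aD (lie_atlas S) U b ->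
     smooth_map_on aD (lie_atlas S) U c ->
     (forall x, U x -> x = (diagD (a x) * twist sigma' (i (b x)))%g) ->
     (forall x, U x -> x = (i (c x) * twist sigma' (diagD (h x)))%g) ->
     [/\ left_moment_map aD piDs U ex exS (kap_G (-1)) L_G b,
         left_moment_map aD piDs U exS ex (kap_S (-1)) L_S h,
         right_moment_map aD piDs U ex exS (kap_G 1) R_G c &
         right_moment_map aD piDs U exS ex (kap_S 1) R_S a]).
Proof.
move=> aD bD bDs piDs L L_G L_S R_D R_G R_S kap_G kap_S.
have gD := good_double G; have gG := manifold_good (lie_manifold G).
have gS := manifold_good (lie_manifold S); have expS := ds_exp hS.
have hi : lie_hom (lie_atlas S) aD exS (exd ex) i (@emb_gs R g).
  split; [exact: ds_morph hS| |exact: ds_tangent hS|exact: emb_gsZ].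
  by move=> x; apply: (smooth_map_onP i gS gD openT).1 => //; exact: ds_smooth hS.
have hdiag := @diag_hom R g G ex.
have idP : is_poisson_map aD aD bD bD id.
  split=> //; apply/smooth_map_onP => //; first exact: openT.
  by move=> x _; exact: smooth_map_at_id.
have [diM _ _ diP] := hbG; have [iM _ _ iP] := hbS.
split; first split.
- have -> : L = (fun q : (G * G) * (G * G) => actL sigma' (q.1, q.2)).
    by apply/funext => -[].
  exact (left_action_subgroup hG hAd hsigma hs hsp gD (fun x y => erefl) idP).
- have -> : R_D = (fun q : (G * G) * (G * G) => actR (q.1, q.2)).
    by apply/funext => -[].
  exact (right_action_subgroup hG hAd s gD (fun x y => erefl) idP).
split; first split.
- exact (left_action_subgroup hG hAd hsigma hs hsp gG diM diP).
- exact (right_action_subgroup hG hAd s gG diM diP).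
- exact (left_action_subgroup hG hAd hsigma hs hsp gS iM iP).
- exact (right_action_subgroup hG hAd s gS iM iP).
split; first by move=> e he; split; [exact: dual_pairing_g|exact: dual_pairing_gs].
move=> U a h b c oU _ sa sh sb sc xab xch.
have m1 : (-1 : R) * -1 = 1 by rewrite mulrNN mulr1.
have p1 : (1 : R) * 1 = 1 by rewrite mulr1.
have rd_g (X : g) : rd (emb_g X) = (-1 : R) *: emb_g X by rewrite scaleN1r rd_emb_g.
have rd_gN (X : g) : rd (emb_g X) = - ((1 : R) *: emb_g X) by rewrite scale1r rd_emb_g.
have rd_gs (X : g) : rd (emb_gs X) = (1 : R) *: emb_gs X by rewrite scale1r rd_emb_gs.
have rd_gsN (X : g) : rd (emb_gs X) = - ((-1 : R) *: emb_gs X).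
  by rewrite scaleN1r opprK rd_emb_gs.
have iso_g := @emb_g_iso R g; have iso_gs := @emb_gs_iso R g.
split.
- refine (left_moment_map_factor hG hAd hsigma hs hsp hG expS hdiag hi
    m1 rd_g rd_gsN iso_g iso_gs oU _ sa sb xab).
  by [].
- refine (left_moment_map_factor hG hAd hsigma hs hsp expS hG hi hdiag
    p1 rd_gs rd_gN iso_gs iso_g oU _ sc sh xch).
  by move=> x X; rewrite /kap_S opprK.
- refine (right_moment_map_factor hG hAd hsigma hs hsp hG expS hdiag hi
    m1 rd_g rd_gsN iso_g iso_gs oU _ sc sh xch).
  by move=> x X; rewrite /kap_G mulN1r opprK mul1r.
- refine (right_moment_map_factor hG hAd hsigma hs hsp expS hG hi hdiag
    p1 rd_gs rd_gN iso_gs iso_g oU _ sa sb xab).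
  by move=> x X; rewrite /kap_S mulNr.
Qed.
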